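(* Let $N\ge 2$, let $\Omega\subset\mathbb{R}^N$ be a bounded open set, $p\in(1,\infty)$, $p'=\frac p{p-1}$, $0<\alpha<\beta$, $c=\big(\frac\beta\alpha\big)^{\frac1{p-1}}-1>0$, $0<\kappa<|\Omega|$ and $f\in W^{-1,p'}(\Omega)$. Consider the problem $$(\mathrm{R})\qquad \min\left\{\frac1p\int_\Omega\frac{|\nabla u|^p}{(1+c\,\theta)^{p-1}}\,dx-\langle f,u\rangle:\ u\in W^{1,p}_0(\Omega),\ \theta\in\Theta\right\},\qquad \Theta=\Big\{\theta\in L^\infty(\Omega;[0,1]):\ \int_\Omega\theta\,dx\le\kappa\Big\}.$$ For every solution $(\hat u,\hat\theta)$ of (R), the flux $$\hat\sigma=\frac{|\nabla\hat u|^{p-2}}{(1+c\,\hat\theta)^{p-1}}\nabla\hat u$$ is the unique solution of $$\min_{\sigma\in L^{p'}(\Omega)^N,\ -\mathrm{div}\,\sigma=f}\ \max_{\theta\in\Theta}\ \int_\Omega(1+c\,\theta)|\sigma|^{p'}\,dx ,$$ the function $\hat\theta$ solves $$\max_{\theta\in\Theta}\ \min_{\sigma\in L^{p'}(\Omega)^N,\ -\mathrm{div}\,\sigma=f}\ \int_\Omega(1+c\,\theta)|\sigma|^{p'}\,dx ,$$ and the minimum value in the min-max problem agrees with the maximum value in the max-min problem.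
   Context: $\langle f,u\rangle$ is the duality pairing between $W^{-1,p'}(\Omega)$ and $W^{1,p}_0(\Omega)$; $L^\infty(\Omega;[0,1])$ is the set of measurable functions with values in $[0,1]$ a.e. The equation $-\mathrm{div}\,\sigma=f$ is understood in the sense of distributions in $\Omega$. The vector $|\xi|^{p-2}\xi$ is understood to be $0$ when $\xi=0$. *)

(* Defs.v *)
From HB Require Import structures.
From mathcomp Require Import all_boot all_order all_algebra.
From mathcomp Require Import all_classical all_reals all_analysis.

Set Implicit Arguments.
Unset Strict Implicit.
Unset Printing Implicit Defensive.

Import Order.TTheory GRing.Theory Num.Theory.
Import numFieldNormedType.Exports.

Local Open Scope classical_set_scope.
Local Open Scope ring_scope.

(* The sigma-algebra on 'rV[T]_n generated by the coordinates, as the library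
   does for n.-tuple T; for T = R it is the Borel sigma-algebra of R^n. *)
Definition measure_rV_display : measure_display -> measure_display.
Proof. exact. Qed.

Section measurable_rV.
Context {d} {T : measurableType d} (n : nat).

Definition rV_coord (i : 'I_n) (x : 'rV[T]_n) : T := x ord0 i.

Let rV_set0 : g_sigma_preimage rV_coord set0.
Proof. exact: sigma_algebra0. Qed.

Let rV_setC A : g_sigma_preimage rV_coord A -> g_sigma_preimage rV_coord (~` A).
Proof. exact: sigma_algebraC. Qed.

Let rV_bigcup (F : _^nat) : (forall i, g_sigma_preimage rV_coord (F i)) ->
  g_sigma_preimage rV_coord (\bigcup_i (F i)).
Proof. exact: sigma_algebra_bigcup. Qed.

HB.instance Definition _ := @isMeasurable.Build (measure_rV_display d)
  'rV[T]_n (g_sigma_preimage rV_coord) rV_set0 rV_setC rV_bigcup.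

Lemma measurable_rV_coord (i : 'I_n) : measurable_fun [set: 'rV[T]_n] (rV_coord i).
Proof.
move=> _ Y mY; rewrite setTI; apply: sub_sigma_algebra => /=.
rewrite -bigcup_seq/=; exists i => /=; first by rewrite mem_index_enum.
by exists Y => //; rewrite setTI.
Qed.

Lemma measurable_fun_rVP d1 (T1 : measurableType d1) (f : T1 -> 'rV[T]_n) :
  measurable_fun [set: T1] f <->
  forall i, measurable_fun [set: T1] (rV_coord i \o f).
Proof.
split=> [mf i|mf]; first exact: (measurableT_comp (measurable_rV_coord i)).
have sub : g_sigma_preimage rV_coord `<=`
    [set B | measurable ([set: T1] `&` f @^-1` B)].
  apply: smallest_sub.
    split=> [|B /= mB|F /= mF].
    - by rewrite /= preimage_set0 setI0.
    - by move: mB; rewrite !setTI setTD -preimage_setC; exact: measurableC.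
    - rewrite setTI preimage_bigcup; apply: bigcup_measurable => k _.
      by have := mF k; rewrite setTI.
  rewrite -bigcup_seq => B [i _ [C mC <-]] /=.
  by rewrite setTI; exact: mf.
by move=> _ B mB; exact: sub.
Qed.

End measurable_rV.

Section lebesgue_rV.
Context {R : realType}.

Definition rV_cons (n : nat) (z : R * 'rV[R]_n) : 'rV[R]_n.+1 :=
  row_mx (const_mx z.1 : 'rV[R]_1) z.2.

Lemma measurable_rV_cons n : measurable_fun [set: R * 'rV[R]_n] (@rV_cons n).
Proof.
apply/measurable_fun_rVP => i.
case: (@split_ordP 1 n i) => j ->.
  rewrite (_ : _ \o _ = fst)//.
  by apply/funext => z; exact: etrans (row_mxEl _ _ _ _) (mxE _ _ _ _).
rewrite (_ : _ \o _ = rV_coord j \o snd).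
  by apply: measurableT_comp => //; exact: measurable_rV_coord.
by apply/funext => z; exact: row_mxEr.
Qed.

Definition rV_uncons (n : nat) (x : 'rV[R]_n.+1) : R * 'rV[R]_n :=
  (x ord0 ord0, @rsubmx R 1 1 n x).

Lemma rV_consK n : cancel (@rV_cons n) (@rV_uncons n).
Proof.
move=> [a v]; congr pair; last exact: (@row_mxKr _ 1 1 n).
by rewrite (_ : ord0 = @lshift 1 n ord0); [exact: etrans (row_mxEl _ _ _ _) (mxE _ _ _ _)|exact/val_inj].
Qed.

Lemma measurable_rV_uncons n : measurable_fun [set: 'rV[R]_n.+1] (@rV_uncons n).
Proof.
apply/measurable_fun_pairP; split; first exact: measurable_rV_coord.
apply/measurable_fun_rVP => i.
rewrite (_ : _ \o _ = rV_coord (@rshift 1 n i)); first exact: measurable_rV_coord.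
by apply/funext => x; exact: mxE.
Qed.

Definition lebesgue_rV_step (n : nat)
    (m : {sigma_finite_measure set 'rV[R]_n -> \bar R}) :
    set 'rV[R]_n.+1 -> \bar R :=
  pushforward (lebesgue_measure \x m)%E (@rV_cons n).

Section step.
Variables (n : nat) (m : {sigma_finite_measure set 'rV[R]_n -> \bar R}).

HB.instance Definition _ := Measure.copy (lebesgue_rV_step m)
  (measure_function_pushforward__canonical__measure_function_Measure
     (lebesgue_measure \x m)%E (measurable_rV_cons (n := n))).

Let lebesgue_rV_step_sigma_finite : sigma_finite setT (lebesgue_rV_step m).
Proof.
have /sigma_finiteP[F [TF ndF Foo]] := sigma_finiteT (@lebesgue_measure R).
have /sigma_finiteP[G [TG ndG Goo]] := sigma_finiteT m.
exists (fun k => @rV_uncons n @^-1` (F k `*` G k)).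
  rewrite -preimage_bigcup [X in _ @^-1` X](_ : _ = setT)//.
  apply/seteqP; split=> // -[a v] _.
  have [i _ Fi] : (\bigcup_i F i) a by rewrite -TF.
  have [j _ Gj] : (\bigcup_i G i) v by rewrite -TG.
  exists (maxn i j) => //; split=> /=.
  - by move: a Fi; exact/subsetPset/ndF/leq_maxl.
  - by move: v Gj; exact/subsetPset/ndG/leq_maxr.
move=> k; have [mF Fk] := Foo k; have [mG Gk] := Goo k; split.
  rewrite -[X in measurable X]setTI; apply: measurable_rV_uncons => //.
  exact: measurableX.
rewrite /lebesgue_rV_step /pushforward -comp_preimage.
rewrite (_ : _ @^-1` _ = F k `*` G k); last first.
  by apply/funext => z; congr ((_ `*` _) _); exact: rV_consK.
by rewrite product_measure1E// lte_mul_pinfty// ge0_fin_numE.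
Qed.

HB.instance Definition _ := Measure_isSigmaFinite.Build _ _ _
  (lebesgue_rV_step m) lebesgue_rV_step_sigma_finite.

End step.

(* The Lebesgue measure of R^n, as the n-fold product of the one of R. *)
Fixpoint lebesgue_rV (n : nat) : {sigma_finite_measure set 'rV[R]_n -> \bar R} :=
  match n with
  | 0 => [the {sigma_finite_measure set _ -> \bar R} of dirac (0 : 'rV[R]_0)]
  | k.+1 => [the {sigma_finite_measure set _ -> \bar R} of
               lebesgue_rV_step (lebesgue_rV k)]
  end.

Lemma lebesgue_rV_box n (A : 'I_n -> set R) : (forall i, measurable (A i)) ->
  lebesgue_rV n [set x | forall i, A i (x ord0 i)] =
  (\prod_(i < n) lebesgue_measure (A i))%E.
Proof.
elim: n A => [|n IHn] A mA.
  rewrite big_ord0 /= diracE mem_set//; case=> //.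
rewrite big_ord_recl -IHn//.
have cons0 a (v : 'rV[R]_n) : rV_cons (a, v) ord0 ord0 = a.
  by case: (rV_consK (a, v)).
have consS a (v : 'rV[R]_n) i : rV_cons (a, v) ord0 (lift ord0 i) = v ord0 i.
  have -> : lift ord0 i = rshift 1 i :> 'I_n.+1 by exact/val_inj.
  exact: row_mxEr.
pose D := [set x : 'rV[R]_n | forall i, A (lift ord0 i) (x ord0 i)].
rewrite -[X in (_ * X)%E]/(lebesgue_rV n D).
have mD : measurable D.
  have -> : D = \bigcap_(i in [set` index_enum 'I_n])
      (rV_coord i @^-1` A (lift ord0 i)).
    by apply/seteqP; split=> x Dx i *; apply: Dx => /=; rewrite mem_index_enum.
  rewrite bigcap_seq; apply: bigsetI_measurable => i _.
  by rewrite -[X in measurable X]setTI; exact: measurable_rV_coord.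
rewrite -product_measure1E//; last exact: mA.
rewrite /= /lebesgue_rV_step /pushforward; congr (_ _).
apply/seteqP; split=> -[a v] /=.
  move=> Aav; split=> [|i] /=; first by rewrite -[X in A _ X](cons0 a v).
  by rewrite -[X in A _ X](consS a).
move=> [/= Aa Dv] i; case: (unliftP ord0 i) => [j|] ->; last by rewrite cons0.
by rewrite consS; exact: Dv.
Qed.

End lebesgue_rV.

Section euclidean.
Context {R : realType} {N : nat}.
Implicit Types (x y : 'rV[R]_N) (g : 'rV[R]_N -> R).

Definition dotv x y : R := \sum_(i < N) x ord0 i * y ord0 i.

(* `|x| on 'rV[R]_N is the sup norm; this is the Euclidean one. *)
Definition enorm x : R := Num.sqrt (dotv x x).

Definition partial (i : 'I_N) g : 'rV[R]_N -> R :=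
  fun x => 'D_(delta_mx ord0 i) g x.

Definition grad g : 'rV[R]_N -> 'rV[R]_N := fun x => \row_i partial i g x.

(* C^infinity: the iterated partial derivatives of all orders are
   differentiable everywhere. *)
Definition smooth g : Prop :=
  forall (s : seq 'I_N) x, differentiable (foldr partial g s) x.

(* C_c^infinity(Omega), each function being extended by 0 to R^N. *)
Definition test_function (Omega : set 'rV[R]_N) g : Prop :=
  let supp := closure [set x | g x != 0] in
  [/\ smooth g, compact supp & supp `<=` Omega].

End euclidean.

Section sobolev.
Context {R : realType} {N : nat} (Omega : set 'rV[R]_N) (p : R).
Implicit Types (u v : 'rV[R]_N -> R) (G sigma : 'rV[R]_N -> 'rV[R]_N).
Local Notation mu := (@lebesgue_rV R N).
Local Open Scope ereal_scope.

Definition Lp_norm u : \bar R := 'N[mu]_p%:E[(EFin \o u) \_ Omega].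

Definition in_Lp u : Prop := measurable_fun Omega u /\ Lp_norm u < +oo.

Definition in_LpV sigma : Prop :=
  measurable_fun Omega sigma /\ Lp_norm (enorm \o sigma) < +oo.

Definition weak_gradient u G : Prop :=
  forall (phi : 'rV[R]_N -> R) (i : 'I_N), test_function Omega phi ->
    \int[mu]_(x in Omega) (u x * partial i phi x)%:E =
    - \int[mu]_(x in Omega) (G x ord0 i * phi x)%:E.

(* A Sobolev function is handled together with (a representative of) its weak
   gradient, which is unique almost everywhere. *)
Definition W1p u G : Prop := [/\ in_Lp u, in_LpV G & weak_gradient u G].

Definition W1p_norm u G : \bar R := Lp_norm u + Lp_norm (enorm \o G).

(* W^{1,p}_0(Omega): the closure of C_c^infinity(Omega) in W^{1,p}(Omega). *)
Definition W1p0 u G : Prop := W1p u G /\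
  forall e : R, (0 < e)%R -> exists2 phi, test_function Omega phi &
    W1p_norm (u \- phi)%R (fun x => G x - grad phi x)%R < e%:E.

(* W^{-1,p'}(Omega): the continuous linear forms on W^{1,p}_0(Omega); only the
   values of f on W^{1,p}_0(Omega) matter. *)
Definition dual_W1p0 (f : ('rV[R]_N -> R) -> R) : Prop :=
  (forall (a : R) u G v H, W1p0 u G -> W1p0 v H ->
    f (fun x => a * u x + v x)%R = (a * f u + f v)%R) /\
  (exists C : R, forall u G, W1p0 u G -> `|f u|%:E <= C%:E * W1p_norm u G).

(* - div sigma = f in the sense of distributions in Omega *)
Definition minus_div sigma (f : ('rV[R]_N -> R) -> R) : Prop :=
  forall phi : 'rV[R]_N -> R, test_function Omega phi ->
    \int[mu]_(x in Omega) (dotv (sigma x) (grad phi x))%:E = (f phi)%:E.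

End sobolev.

Section optimization.
Context {R : realType} {X : Type}.
Local Open Scope ereal_scope.

Definition is_min (D : set X) (F : X -> \bar R) (x : X) : Prop :=
  D x /\ forall y, D y -> F x <= F y.

Definition is_max (D : set X) (F : X -> \bar R) (x : X) : Prop :=
  D x /\ forall y, D y -> F y <= F x.

End optimization.

Section minmax.
Context {R : realType} {X Y : Type}.
Variables (A : set X) (B : set Y) (J : X -> Y -> \bar R).
Local Open Scope ereal_scope.

(* x solves min_{x in A} max_{y in B} J x y, whose minimum value is v; as the
   problem is written with a max, M x is an attained maximum for all x in A. *)
Definition solves_minmax (x : X) (v : \bar R) : Prop :=
  exists M : X -> \bar R,
    [/\ forall a, A a -> exists2 y, is_max B (J a) y & J a y = M a,
        is_min A M x & M x = v].

(* y solves max_{y in B} min_{x in A} J x y, whose maximum value is v. *)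
Definition solves_maxmin (y : Y) (v : \bar R) : Prop :=
  exists m : Y -> \bar R,
    [/\ forall b, B b -> exists2 x, is_min A (J ^~ b) x & J x b = m b,
        is_max B m y & m y = v].

End minmax.

Section relaxed_problem.
Context {R : realType} {N : nat} (Omega : set 'rV[R]_N) (p c kappa : R)
  (f : ('rV[R]_N -> R) -> R).
Implicit Types (u theta : 'rV[R]_N -> R) (G sigma : 'rV[R]_N -> 'rV[R]_N).
Local Notation mu := (@lebesgue_rV R N).
Local Open Scope ereal_scope.

Definition Theta theta : Prop :=
  [/\ measurable_fun Omega theta,
      {ae mu, forall x, Omega x -> (0 <= theta x <= 1)%R} &
      \int[mu]_(x in Omega) (theta x)%:E <= kappa%:E].

(* G stands for the weak gradient of u. *)
Definition energy u G theta : \bar R :=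
  p^-1%:E * \int[mu]_(x in Omega)
    (enorm (G x) `^ p / (1 + c * theta x) `^ (p - 1))%:E - (f u)%:E.

Definition solves_R u G theta : Prop :=
  [/\ W1p0 Omega p u G, Theta theta &
      forall v H eta, W1p0 Omega p v H -> Theta eta ->
        energy u G theta <= energy v H eta].

(* For G x = 0 this is 0, whatever the value of 0 `^ (p - 2). *)
Definition flux G theta : 'rV[R]_N -> 'rV[R]_N := fun x =>
  (enorm (G x) `^ (p - 2) / (1 + c * theta x) `^ (p - 1)) *: G x.

(* With q = p' these are the feasible set and the objective of the
   min-max and max-min problems. *)
Definition admissible_flux (q : R) sigma : Prop :=
  in_LpV Omega q sigma /\ minus_div Omega sigma f.

Definition dual_energy (q : R) sigma theta : \bar R :=
  \int[mu]_(x in Omega) ((1 + c * theta x) * enorm (sigma x) `^ q)%:E.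

End relaxed_problem.

(* Main.v *)
From HB Require Import structures.
Require Import Defs.
From mathcomp Require Import all_boot all_order all_algebra.
From mathcomp Require Import all_classical all_reals all_analysis.
From mathcomp Require Import measurable_realfun ring lra.

Import Order.TTheory GRing.Theory Num.Theory.
Import numFieldNormedType.Exports.

Local Open Scope classical_set_scope.
Local Open Scope ring_scope.

Set Implicit Arguments.
Unset Strict Implicit.
Unset Printing Implicit Defensive.

(** Let q be the exponent conjugate to p and J(sigma, theta) the integral over
    Omega of (1 + c theta) |sigma|^q.  The three assertions say that
    (sigma, theta) is a saddle point of J, that the inner extrema are attained,
    and that J(., theta) has a single minimiser.  The saddle inequalities come
    from the two first order conditions at a minimiser (u, theta) of the
    relaxed energy.

    - Moving u along a test function phi gives that the integral of
      sigma . grad phi is f(phi): the flux is admissible ([opt_flux_div]).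
    - Moving theta along the segment to another density eta gives that the
      integral of |sigma|^q (eta - theta) is at most 0, because
      |sigma|^q = |grad u|^p / (1 + c theta)^p is, up to a negative factor, the
      derivative of the energy density in theta.  This is
      J(sigma, eta) <= J(sigma, theta) ([opt_flux_max]).
    - The duality maps of p and q are inverse to each other:
      (1 + c theta) |sigma|^(q-2) sigma = grad u ([flux_inverse]).  Hence the
      tangent inequality of |.|^q at sigma bounds J(tau, theta) - J(sigma, theta)
      from below by q times the integral of grad u . (tau - sigma).  The field
      tau - sigma is orthogonal to the gradients of all test functions, hence to
      their limit grad u, and J(sigma, theta) <= J(tau, theta) follows
      ([W1p0_orthogonal], [opt_flux_min]).

    Both first order conditions are obtained without differentiating under the
    integral: a convex function lies above its tangents, so the difference
    quotients of the energy are bounded by the derivative at the moved point,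
    and this derivative converges by dominated convergence.

    The maximum over theta at fixed sigma is attained by the bathtub principle:
    fill the set where |sigma|^q is largest until the mass kappa is used
    ([bathtub]).  The minimum over sigma at fixed theta is attained by the
    direct method in strong form.  The function |.|^q is uniformly convex in the
    sense that |x - y|^q is at most eps (|x|^q + |y|^q) plus a multiple of the
    convexity defect at the midpoint ([enorm_powR_uniform_convex]).  Integrated,
    this makes minimising sequences Cauchy, with summable steps after a suitable
    choice; they converge almost everywhere under an integrable bound, and
    Fatou's lemma concludes ([wenergy_minimizer]).  The same inequality gives
    uniqueness ([wenergy_minimizer_unique]).

    A test function has to be recognised as an element of W^{1,p}_0 with its
    classical gradient before it can serve as a variation.  This is
    integration by parts ([test_by_parts]), which reduces to the fact that a
    partial derivative of a compactly supported function has integral 0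
    ([Rintegral_partial_eq0]): its difference quotients have integral 0 by
    translation invariance of the Lebesgue measure ([lebesgue_rV_shift]). *)

(** * Integrals of real-valued functions *)

Section real_integral.
Context d (T : measurableType d) (R : realType).
Variables (mu : {measure set T -> \bar R}) (D : set T).
Hypothesis mD : measurable D.
Implicit Types (f g h : T -> R).

Lemma integrable_EFinD f g : mu.-integrable D (EFin \o f) ->
  mu.-integrable D (EFin \o g) -> mu.-integrable D (EFin \o (fun x => f x + g x)).
Proof. by move=> If Ig; have := integrableD mD If Ig; exact. Qed.

Lemma integrable_EFinZ (a : R) f : mu.-integrable D (EFin \o f) ->
  mu.-integrable D (EFin \o (fun x => a * f x)).
Proof. by move=> If; have := integrableZl mD a If; exact. Qed.

Lemma integrable_EFinB f g : mu.-integrable D (EFin \o f) ->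
  mu.-integrable D (EFin \o g) -> mu.-integrable D (EFin \o (fun x => f x - g x)).
Proof. by move=> If Ig; have := integrableB mD If Ig; exact. Qed.

Lemma integrable_measurable f : mu.-integrable D (EFin \o f) -> measurable_fun D f.
Proof. by move=> /integrableP[/measurable_EFinP]. Qed.

Lemma EFin_Rintegral f : mu.-integrable D (EFin \o f) ->
  (\int[mu]_(x in D) (f x)%:E)%E = (\int[mu]_(x in D) f x)%:E.
Proof. by move=> If; rewrite /Rintegral fineK//; exact: integrable_fin_num. Qed.

Lemma ge0_integrable f : measurable_fun D f -> (forall x, D x -> 0 <= f x) ->
  (\int[mu]_(x in D) (f x)%:E < +oo)%E -> mu.-integrable D (EFin \o f).
Proof.
move=> mf f0 foo; apply/integrableP; split; first exact/measurable_EFinP.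
under eq_integral => x do
  [rewrite inE => Dx; rewrite /= ger0_norm; last exact: f0].
exact: foo.
Qed.

Lemma ae_dominated_integrable f g : measurable_fun D f ->
  {ae mu, forall x, D x -> `|f x| <= g x} ->
  mu.-integrable D (EFin \o g) -> mu.-integrable D (EFin \o f).
Proof.
move=> mf fg Ig; apply/integrableP; split; first exact/measurable_EFinP.
have /integrableP[mg] := Ig; apply: le_lt_trans.
apply: ae_ge0_le_integral => //.
- by apply: measurableT_comp => //; exact/measurable_EFinP.
- by apply: measurableT_comp.
by apply: filterS fg => x + Dx => /(_ Dx) fgx; rewrite /= lee_fin (le_trans fgx)// ler_norm.
Qed.

Lemma integrable_cst_fun (a : R) : (mu D < +oo)%E ->
  mu.-integrable D (EFin \o (fun=> a)).
Proof.
move=> Doo.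
apply: (@measurable_bounded_integrable _ _ _ mu (fun=> a) D) => //.
exact: bounded_cst.
Qed.

Lemma ae_le_Rintegral f g : mu.-integrable D (EFin \o f) ->
  mu.-integrable D (EFin \o g) -> {ae mu, forall x, D x -> f x <= g x} ->
  \int[mu]_(x in D) f x <= \int[mu]_(x in D) g x.
Proof.
move=> If Ig fg; rewrite -subr_ge0 -RintegralB//.
have Igf := integrable_EFinB Ig If.
rewrite /Rintegral (@ae_eq_integral _ _ _ mu D (fun x => (`|g x - f x|)%:E))//.
- by apply: fine_ge0; apply: integral_ge0 => x _; rewrite lee_fin.
- exact: measurable_int Igf.
- by apply/measurable_EFinP/measurableT_comp => //; exact: integrable_measurable Igf.
by apply: filterS fg => x + Dx => /(_ Dx) fgx; rewrite ger0_norm// subr_ge0.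
Qed.

Lemma ae_eq_Rintegral f g : measurable_fun D f -> measurable_fun D g ->
  {ae mu, forall x, D x -> f x = g x} ->
  \int[mu]_(x in D) f x = \int[mu]_(x in D) g x.
Proof.
move=> mf mg fg; rewrite /Rintegral; congr fine; apply: ae_eq_integral => //.
- exact/measurable_EFinP.
- exact/measurable_EFinP.
by apply: filterS fg => x + Dx => /(_ Dx) ->.
Qed.

Lemma dominated_Rintegral (F : nat -> T -> R) f g :
  (forall n, measurable_fun D (F n)) -> measurable_fun D f ->
  {ae mu, forall x, D x -> F ^~ x @ \oo --> f x} ->
  mu.-integrable D (EFin \o g) ->
  {ae mu, forall x, D x -> forall n, `|F n x| <= g x} ->
  (fun n => \int[mu]_(x in D) F n x) @ \oo --> \int[mu]_(x in D) f x.
Proof.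
move=> mF mf Ff Ig Fg.
have [] := @dominated_convergence _ _ _ mu D mD (fun n => EFin \o F n)
  (EFin \o f) (EFin \o g).
- by move=> n; apply/measurable_EFinP.
- exact/measurable_EFinP.
- by apply: filterS Ff => x + Dx => /(_ Dx) Fx; apply: cvg_comp Fx _ => //; exact: cvg_refl.
- exact: Ig.
- by apply: filterS Fg => x + n Dx => /(_ Dx n) Fx; rewrite lee_fin.
move=> If _; rewrite /= => cF; apply: fine_cvg.
by rewrite /Rintegral fineK//; exact: integrable_fin_num If.
Qed.

Lemma fatou_Rintegral (F : nat -> T -> R) f (M : nat -> R) (m : R) :
  (forall n, mu.-integrable D (EFin \o F n)) -> measurable_fun D f ->
  (forall n x, D x -> 0 <= F n x) -> (forall x, D x -> 0 <= f x) ->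
  {ae mu, forall x, D x -> F ^~ x @ \oo --> f x} ->
  (forall n, \int[mu]_(x in D) F n x <= M n) -> M @ \oo --> m ->
  mu.-integrable D (EFin \o f) /\ \int[mu]_(x in D) f x <= m.
Proof.
move=> IF mf F0 f0 Ff FM Mm.
have mF n : measurable_fun D (EFin \o F n) by exact: measurable_int (IF n).
have le_m : (\int[mu]_(x in D) (f x)%:E <= m%:E)%E.
  rewrite (@ae_eq_integral _ _ _ mu D (fun x => limn_einf (fun n => (F n x)%:E)))//; last 3 first.
  - exact/measurable_EFinP.
  - rewrite (_ : (fun x => _) = (fun x => - limn_esup (fun n => - (F n x)%:E))%E).
      apply: measurableT_comp; first exact: oppe_measurable.
      apply: measurable_fun_limn_esup => n.
      by apply: measurableT_comp; [exact: oppe_measurable|exact: mF].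
    apply/funext => x; rewrite -[LHS]oppeK -limn_esupN.
    by [].
  - apply: filterS Ff => x + Dx => /(_ Dx) Fx; symmetry.
    have cF : (F n x)%:E @[n --> \oo] --> (f x)%:E by apply: cvg_comp Fx _ => //; exact: cvg_refl.
    by rewrite (cvg_limn_einf_sup cF).1.
  have := @fatou _ _ _ mu D mD (fun n => EFin \o F n) mF.
  move=> /(_ (fun n x Dx => F0 n x Dx)) /le_trans; apply.
  have cM : (M n)%:E @[n --> \oo] --> m%:E by apply: cvg_comp Mm _ => //; exact: cvg_refl.
  rewrite -((cvg_limn_einf_sup cM).1).
  rewrite !limn_einf_lim; apply: lee_lim; [exact: is_cvg_einfs|exact: is_cvg_einfs|].
  apply: nearW => n; apply: le_ereal_inf_tmp => _ [k /= nk <-].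
  apply: ereal_inf_le; eexists; first by exists k.
  by rewrite /= EFin_Rintegral// lee_fin.
have If : mu.-integrable D (EFin \o f).
  by apply: ge0_integrable => //; apply: le_lt_trans le_m _; rewrite ltry.
by split=> //; rewrite -lee_fin -EFin_Rintegral.
Qed.

Lemma Rintegral_le0_ae0 f : mu.-integrable D (EFin \o f) ->
  (forall x, D x -> 0 <= f x) -> \int[mu]_(x in D) f x <= 0 ->
  {ae mu, forall x, D x -> f x = 0}.
Proof.
move=> If f0 le0.
have : (\int[mu]_(x in D) `|(f x)%:E| = 0)%E.
  under eq_integral => x do
    [rewrite inE => Dx; rewrite /= ger0_norm; last exact: f0].
  rewrite EFin_Rintegral//; congr EFin; apply/eqP; rewrite eq_le le0 /=.
  exact: Rintegral_ge0.
move/(ae_eq_integral_abs mu mD (measurable_int mu If)).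
by apply: filterS => x /= + Dx => /(_ Dx) [].
Qed.

End real_integral.

(** * The bathtub principle *)
Section bathtub.
Context d (T : measurableType d) (R : realType).
Variables (mu : {measure set T -> \bar R}) (D : set T).
Hypothesis mD : measurable D.
Hypothesis Doo : (mu D < +oo)%E.
Variables (g : T -> R) (kappa : R).
Hypothesis Ig : mu.-integrable D (EFin \o g).
Hypothesis g0 : forall x, D x -> 0 <= g x.
Hypothesis kappa0 : 0 < kappa.
Hypothesis kappaD : (kappa%:E < mu D)%E.

Let mg : measurable_fun D g := integrable_measurable Ig.

Let Gt (t : R) := D `&` [set x | t < g x].
Let Ge (t : R) := D `&` [set x | t <= g x].
Let Eq (t : R) := D `&` [set x | g x = t].

Let mGt t : measurable (Gt t).
Proof.
have := mg mD (measurable_itv `]t, +oo[); congr (measurable (_ `&` _)).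
by apply/seteqP; split=> x /=; rewrite in_itv/= andbT.
Qed.

Let mGe t : measurable (Ge t).
Proof.
have := mg mD (measurable_itv `[t, +oo[); congr (measurable (_ `&` _)).
by apply/seteqP; split=> x /=; rewrite in_itv/= andbT.
Qed.

Let mEq t : measurable (Eq t).
Proof. by have := mg mD (measurable_set1 t). Qed.

Let mu_fin A : measurable A -> A `<=` D -> mu A \is a fin_num.
Proof.
move=> mA AD; rewrite ge0_fin_numE//; apply: le_lt_trans Doo.
by apply: le_measure => //; rewrite inE.
Qed.

Let GtD t : Gt t `<=` D. Proof. by move=> x []. Qed.
Let EqD t : Eq t `<=` D. Proof. by move=> x []. Qed.

Let Gt_le s t : s <= t -> (mu (Gt t) <= mu (Gt s))%E.
Proof.
move=> st; apply: le_measure; rewrite ?inE// => x [Dx /= tg]; split=> //=.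
exact: le_lt_trans tg.
Qed.

(** The level is the infimum of the t for which the superlevel set [Gt t] has
    measure at most kappa.  Continuity of the measure from below along
    decreasing levels gives the first bound at the infimum itself, continuity
    from above along increasing levels gives the second one; at level 0 the
    latter holds because g is nonnegative and kappa is less than the measure of
    the domain. *)
Lemma bathtub_level : exists t : R, [/\ 0 <= t, (mu (Gt t) <= kappa%:E)%E &
  (kappa%:E <= mu (Gt t) + mu (Eq t))%E].
Proof.
pose A := [set t | 0 <= t /\ (mu (Gt t) <= kappa%:E)%E].
have lbA : has_lbound A by exists 0 => t [].
have A0 : A !=set0.
  have cF : mu \o (fun n : nat => Gt n%:R) @ \oo --> mu (\bigcap_n Gt n%:R).
    apply: nonincreasing_cvg_mu => //.
    - by rewrite -ge0_fin_numE//; exact: mu_fin.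
    - exact: bigcap_measurable.
    - move=> m n mn; apply/subsetPset => x [Dx /= ng]; split=> //=.
      by apply: le_lt_trans ng; rewrite ler_nat.
  rewrite (_ : \bigcap_n _ = set0) ?measure0 in cF; last first.
    apply/seteqP; split=> // x gx.
    have [_ /=] := gx (Num.truncn (g x)).+1 I.
    by rewrite ltNge ltW// truncnS_gt.
  apply: contrapT => noA.
  suff : (kappa%:E <= 0)%E by rewrite lee_fin leNgt kappa0.
  apply: (cvge_ge _ cF); apply: nearW => n /=; rewrite leNgt; apply/negP => nA.
  by apply: noA; exists n%:R; split; [exact: ler0n|exact: ltW].
pose t := inf A.
have t0 : 0 <= t by apply: lb_le_inf => // s [].
have Ft : (mu (Gt t) <= kappa%:E)%E.
  have UE : \bigcup_n Gt (t + n.+1%:R^-1) = Gt t.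
    apply/seteqP; split=> [x [n _ [Dx /= tg]]|x [Dx /= tg]].
      by split=> //=; apply: le_lt_trans tg; rewrite lerDl.
    have [n /= ng] := ltr_add_invr tg.
    by exists n => //; split.
  have cF : mu \o (fun n : nat => Gt (t + n.+1%:R^-1)) @ \oo --> mu (Gt t).
    rewrite -UE; apply: nondecreasing_cvg_mu => //.
      exact: bigcup_measurable.
    move=> m n mn; apply/subsetPset => x [Dx /= tg]; split=> //=.
    by apply: le_lt_trans tg; rewrite lerD2l lef_pV2 ?posrE// ler_nat.
  apply: (cvge_le _ cF); apply: nearW => n /=.
  have n0 : 0 < n.+1%:R^-1 :> R by rewrite invr_gt0.
  have [s [s0 Fs] st] := inf_adherent n0 (conj A0 lbA).
  by apply: le_trans Fs; apply: Gt_le; exact: ltW.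
have Get : (kappa%:E <= mu (Ge t))%E.
  have [t_0|tn0] := eqVneq t 0.
    rewrite (_ : Ge t = D) ?ltW//; apply/seteqP; split=> [x []//|x Dx].
    by split=> //=; rewrite t_0 g0.
  have tgt0 : 0 < t by rewrite lt_def tn0.
  have UE : \bigcap_n Gt (t - t / n.+1%:R) = Ge t.
    apply/seteqP; split=> [x H|x [Dx /= tg] n _].
      split; first by have [] := H 0%N I.
      rewrite /= leNgt; apply/negP => gt.
      have d0 : 0 < (t - g x) / t by rewrite divr_gt0// subr_gt0.
      have [n /= ng] := ltr_add_invr d0.
      rewrite add0r ltr_pdivlMr// in ng.
      have [_ /=] := H n I; apply/negP; rewrite -leNgt lerBrDr -lerBrDl ltW//.
      by rewrite mulrC.
    by split=> //=; apply: lt_le_trans tg; rewrite ltrBlDr ltrDl divr_gt0.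
  have cF : mu \o (fun n : nat => Gt (t - t / n.+1%:R)) @ \oo --> mu (Ge t).
    rewrite -UE; apply: nonincreasing_cvg_mu => //.
    - by rewrite -ge0_fin_numE//; exact: mu_fin.
    - exact: bigcap_measurable.
    - move=> m n mn; apply/subsetPset => x [Dx /= tg]; split=> //=.
      apply: le_lt_trans tg; rewrite lerD2l lerN2 ler_pM2l//.
      by rewrite lef_pV2 ?posrE// ler_nat.
  apply: (cvge_ge _ cF); apply: nearW => n /=.
  rewrite leNgt; apply/negP => /ltW Fs.
  have : t <= t - t / n.+1%:R.
    apply: ge_inf => //; split=> //.
    by rewrite subr_ge0 ler_pdivrMr// ler_peMr ?(ltW tgt0)// ler1n.
  by rewrite leNgt ltrBlDr ltrDl divr_gt0.
exists t; split=> //.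
rewrite -measureU//; last first.
  by apply/seteqP; split=> // x [[_ tg] [_ gt]]; move: tg; rewrite /= gt ltxx.
rewrite (_ : Gt t `|` Eq t = Ge t)//; apply/seteqP; split=> x.
  by move=> [[Dx tg]|[Dx gt]]; split=> //=; [exact: ltW|rewrite gt].
by move=> [Dx /=]; rewrite le_eqVlt => /predU1P[tg|tg]; [right|left].
Qed.

(** A maximiser is 1 above the level t, 0 below, and a constant in between on the
    set where g equals t; the constant is chosen so that the whole mass kappa is
    used, which makes atoms and plateaus harmless.  It is optimal because
    (eta - theta) (g - t) <= 0 pointwise. *)
Lemma bathtub : exists theta : T -> R, [/\ measurable_fun D theta,
    forall x, D x -> 0 <= theta x <= 1,
    \int[mu]_(x in D) theta x <= kappa &
    forall eta : T -> R, measurable_fun D eta ->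
      {ae mu, forall x, D x -> 0 <= eta x <= 1} ->
      \int[mu]_(x in D) eta x <= kappa ->
      \int[mu]_(x in D) (eta x * g x) <= \int[mu]_(x in D) (theta x * g x)].
Proof.
have [t [t0 aE bE]] := bathtub_level.
pose a := fine (mu (Gt t)); pose e := fine (mu (Eq t)).
have aF : mu (Gt t) = a%:E by rewrite fineK// mu_fin.
have eF : mu (Eq t) = e%:E by rewrite fineK// mu_fin.
rewrite aF lee_fin in aE; rewrite aF eF -EFinD lee_fin in bE.
have e0 : 0 <= e by exact: fine_ge0.
(* when the plateau is negligible, e = 0 and the division gives s = 0 *)
pose s := (kappa - a) / e.
have s0 : 0 <= s by rewrite divr_ge0// subr_ge0.
have sek : a + s * e = kappa.
  have [e_0|en0] := eqVneq e 0; last by rewrite /s divfK// addrC subrK.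
  by rewrite e_0 mulr0 addr0; apply/eqP; rewrite eq_le aE/=; rewrite e_0 addr0 in bE.
have s1 : s <= 1.
  have [e_0|en0] := eqVneq e 0; first by rewrite /s e_0 invr0 mulr0.
  by rewrite ler_pdivrMr ?mul1r ?lerBlDl// lt_def en0.
pose theta x : R := \1_(Gt t) x + s * \1_(Eq t) x.
have Ic := integrable_cst_fun mD 1 Doo.
have Iind A : measurable A -> mu.-integrable D (EFin \o (\1_A : T -> R)).
  move=> mA; apply: (ae_dominated_integrable mD _ _ Ic); first exact: measurable_indic.
  by apply: nearW => x _; rewrite indicE; case: (_ \in _); rewrite ?normr1 ?normr0.
have I1 : mu.-integrable D (EFin \o \1_(Gt t)).
  exact: Iind.
have I2 : mu.-integrable D (EFin \o \1_(Eq t)) by exact: Iind.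
have Ith : mu.-integrable D (EFin \o theta).
  by apply: integrable_EFinD => //; exact: integrable_EFinZ.
have thE x : D x -> theta x = if t < g x then 1 else if g x == t then s else 0.
  move=> Dx; rewrite /theta !indicE.
  case: ltP => [tg|gt].
    rewrite mem_set// memNset ?mulr0 ?addr0// => -[_ /= gt].
    by rewrite gt ltxx in tg.
  rewrite memNset ?add0r; last by move=> [_ /=]; rewrite ltNge gt.
  case: eqP => [gE|gN]; first by rewrite mem_set ?mulr1.
  by rewrite memNset ?mulr0// => -[].
have th01 x : D x -> 0 <= theta x <= 1.
  by move=> Dx; rewrite thE//; case: ifP => _; [rewrite ler01 lexx|case: ifP => _; rewrite ?s0 ?s1// lexx ler01].
have thI : \int[mu]_(x in D) theta x = kappa.
  rewrite RintegralD//; last exact: integrable_EFinZ.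
  rewrite RintegralZl// /Rintegral !integral_indic//.
  by rewrite !setIidl// aF eF.
have Ipg (eta : T -> R) : measurable_fun D eta -> {ae mu, forall x, D x -> 0 <= eta x <= 1} ->
    mu.-integrable D (EFin \o (fun x => eta x * g x)).
  move=> meta eta01; apply: (ae_dominated_integrable mD _ _ Ig).
    exact: measurable_funM.
  apply: filterS eta01 => x + Dx => /(_ Dx)/andP[h0 h1].
  by rewrite ger0_norm ?mulr_ge0 ?g0// ler_piMl// g0.
exists theta; split=> //.
- exact: integrable_measurable Ith.
- by rewrite thI.
move=> eta meta eta01 etaI.
have Ieta : mu.-integrable D (EFin \o eta).
  apply: (ae_dominated_integrable mD meta _ Ic).
  by apply: filterS eta01 => x + Dx => /(_ Dx)/andP[h0 h1]; rewrite ger0_norm.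
have Ithg : mu.-integrable D (EFin \o (fun x => theta x * g x)).
  by apply: Ipg; [exact: integrable_measurable Ith|exact: nearW].
have Idiff := integrable_EFinZ mD t (integrable_EFinB mD Ieta Ith).
apply: (@le_trans _ _ (\int[mu]_(x in D) (theta x * g x + t * (eta x - theta x)))).
  apply: (ae_le_Rintegral mD) => //; [exact: Ipg|exact: integrable_EFinD|].
  apply: filterS eta01 => x + Dx => /(_ Dx)/andP[h0 h1].
  rewrite -subr_ge0 (_ : _ - _ = (theta x - eta x) * (g x - t)); last by ring.
  rewrite thE//; case: ltP => [tg|gt].
    by rewrite mulr_ge0// subr_ge0// ltW.
  case: eqP => [->|_]; first by rewrite subrr mulr0.
  by rewrite mulr_le0// ?sub0r ?oppr_le0// subr_le0.
rewrite RintegralD// RintegralZl//; last exact: integrable_EFinB.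
rewrite RintegralB// thI gerDl mulr_ge0_le0// subr_le0//.
Qed.

End bathtub.

(** * Convexity inequalities for real powers *)
Section powers.
Context {R : realType}.
Implicit Types a b p q r t x y : R.

Lemma gt0_powRE a r : 0 < a -> a `^ r = expR (r * ln a).
Proof. by move=> a0; rewrite /powR gt_eqF. Qed.

Lemma gt0_powRD a r t : 0 < a -> a `^ (r + t) = a `^ r * a `^ t.
Proof. by move=> a0; rewrite powRD// (gt_eqF a0) implybT. Qed.

(** This is the tangent inequality at a of the p-th power, strict off a.  After
    division by a^(p-1) b it reads
    (p - 1) exp(u - v) + exp((p - 1)(v - u)) > p with u = ln a and v = ln b,
    and the bounds 1 + z <= exp z add up to exactly p. *)
Lemma young_powR_lt a b p : 1 < p -> 0 < a -> 0 <= b -> a != b ->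
  p * a `^ (p - 1) * b < (p - 1) * a `^ p + b `^ p.
Proof.
move=> p1 a0; rewrite le_eqVlt => /predU1P[<- _|b0 ab].
  rewrite mulr0 powR0 ?addr0 ?mulr_gt0 ?powR_gt0 ?subr_gt0//.
  by rewrite gt_eqF// (lt_trans _ p1).
have aE : a = expR (ln a) by rewrite lnK// posrE.
have bE : b = expR (ln b) by rewrite lnK// posrE.
rewrite !gt0_powRE//; set u := ln a in aE *; set v := ln b in bE *.
have uv : u != v by apply: contra ab => /eqP uv; rewrite aE bE uv.
rewrite [in X in X < _]bE.
rewrite (_ : p * u = ((p - 1) * u + v) + (u - v)); last by ring.
rewrite (_ : p * v = ((p - 1) * u + v) + (p - 1) * (v - u)); last by ring.
rewrite 2!(expRD ((p - 1) * u + v)) -mulrA -expRD.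
set e := expR ((p - 1) * u + v).
have e0 : 0 < e by exact: expR_gt0.
have h1 : 1 + (u - v) < expR (u - v) by apply: expR_gt1Dx; rewrite subr_eq0.
have h2 : 1 + (p - 1) * (v - u) <= expR ((p - 1) * (v - u)) by exact: expR_ge1Dx.
have -> : (p - 1) * (e * expR (u - v)) + e * expR ((p - 1) * (v - u)) =
  e * ((p - 1) * expR (u - v) + expR ((p - 1) * (v - u))) by ring.
rewrite mulrC ltr_pM2l//.
have : (p - 1) * (1 + (u - v)) < (p - 1) * expR (u - v) by rewrite ltr_pM2l ?subr_gt0.
lra.
Qed.

Lemma young_powR a b p : 1 < p -> 0 <= a -> 0 <= b ->
  p * a `^ (p - 1) * b <= (p - 1) * a `^ p + b `^ p.
Proof.
move=> p1; rewrite le_eqVlt => /predU1P[<- b0|a0 b0].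
  rewrite !powR0 ?subr_eq0 ?gt_eqF//; last by rewrite (lt_trans ltr01 p1).
  by rewrite !mulr0 mul0r add0r powR_ge0.
have [<-|ab] := eqVneq a b; last exact/ltW/young_powR_lt.
rewrite -mulrA [_ * a]mulrC mulr_powRB1// ?(ltW a0)// ?(lt_trans ltr01 p1)//.
lra.
Qed.

Lemma powR_midpoint a b p : 1 < p -> 0 <= a -> 0 <= b ->
  ((a + b) / 2) `^ p <= (a `^ p + b `^ p) / 2.
Proof.
move=> p1 a0 b0; set h := (a + b) / 2.
have h0 : 0 <= h by rewrite divr_ge0 ?addr_ge0.
have := young_powR p1 h0 a0; have := young_powR p1 h0 b0.
have : p * h `^ (p - 1) * a + p * h `^ (p - 1) * b = 2 * p * h `^ p.
  rewrite -(@mulr_powRB1 _ h p)// ?(lt_trans ltr01 p1)// /h; by field.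
lra.
Qed.


(** The tangent inequality at x of the convex function t^(-r), by the same
    exponential bounds. *)
Lemma powRN_tangent x y r : 0 < r -> 0 < x -> 0 < y ->
  x `^ (- r) - r * x `^ (- r - 1) * (y - x) <= y `^ (- r).
Proof.
move=> r0 x0 y0.
have xE : x = expR (ln x) by rewrite lnK// posrE.
have yE : y = expR (ln y) by rewrite lnK// posrE.
rewrite !gt0_powRE//.
rewrite [X in X - x]yE [X in _ - X]xE.
set u := ln x; set v := ln y.
rewrite mulrBr -!mulrA -!expRD.
rewrite (_ : (- r - 1) * u + v = - (r * u) + (v - u)); last by ring.
rewrite (_ : (- r - 1) * u + u = - (r * u)); last by ring.
rewrite (_ : - r * v = - (r * u) + - (r * (v - u))); last by ring.
rewrite mulNr 2!(expRD (- (r * u))).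
set e := expR (- (r * u)).
have e0 : 0 < e by exact: expR_gt0.
have h1 : 1 + (v - u) <= expR (v - u) by exact: expR_ge1Dx.
have h2 : 1 - r * (v - u) <= expR (- (r * (v - u))) by exact: expR_ge1Dx.
rewrite -subr_ge0.
have -> : e * expR (- (r * (v - u))) - (e - (r * (e * expR (v - u)) - r * e)) =
  e * (expR (- (r * (v - u))) - 1 + r * (expR (v - u) - 1)) by ring.
apply: mulr_ge0; first exact: ltW.
have : r * (1 + (v - u)) <= r * expR (v - u) by rewrite ler_pM2l.
lra.
Qed.

Lemma powR_add_le a b p : 0 <= p -> 0 <= a -> 0 <= b ->
  (a + b) `^ p <= 2 `^ p * (a `^ p + b `^ p).
Proof.
move=> p0; wlog ab : a b / a <= b.
  by move=> H a0 b0; case/orP: (le_total a b) => ?; [|rewrite addrC [X in _ * X]addrC]; exact: H.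
move=> a0 b0; apply: (@le_trans _ _ ((2 * b) `^ p)).
  by apply: ge0_ler_powR; rewrite ?nnegrE ?addr_ge0 ?mulr_ge0//; lra.
by rewrite powRM// ler_pM2l ?powR_gt0// lerDr powR_ge0.
Qed.

Lemma cvg_powR (u : nat -> R) a r : (0 < a) || ((0 < r) && (a == 0)) ->
  (forall n, 0 <= u n) -> u @ \oo --> a -> (fun n => u n `^ r) @ \oo --> a `^ r.
Proof.
move=> /orP[a0 _ ua|/andP[r0 /eqP ->] u0 ua].
  have : {for a, continuous (fun x => x `^ r)}.
    apply: differentiable_continuous; apply/derivable1_diffP.
    by apply: derivable_powR; rewrite in_itv/= andbT.
  by move=> /(cvg_comp _ _ ua); exact.
rewrite powR0 ?gt_eqF//; apply/cvgrPdist_lt => e e0.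
have e'0 : 0 < e `^ r^-1 by exact: powR_gt0.
move/cvgrPdist_lt : ua => /(_ _ e'0); apply: filterS => n.
rewrite !sub0r !normrN (ger0_norm (u0 n)) (ger0_norm (powR_ge0 _ _)) => une.
rewrite (_ : e = (e `^ r^-1) `^ r).
  by apply: gt0_ltr_powR; rewrite ?nnegrE ?powR_ge0.
by rewrite -powRrM mulVf ?gt_eqF// powRr1// ltW.
Qed.

End powers.

(** * The Euclidean norm *)
Section euclidean_norm.
Context {R : realType} {N : nat}.
Implicit Types (x y z : 'rV[R]_N) (a : R).

Lemma dotvC x y : dotv x y = dotv y x.
Proof. by apply: eq_bigr => i _; rewrite mulrC. Qed.

Lemma dotvDl x y z : dotv (x + y) z = dotv x z + dotv y z.
Proof. by rewrite -big_split; apply: eq_bigr => i _; rewrite mxE mulrDl. Qed.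

Lemma dotvZl a x y : dotv (a *: x) y = a * dotv x y.
Proof. by rewrite /dotv mulr_sumr; apply: eq_bigr => i _; rewrite mxE mulrA. Qed.

Lemma dotvDr x y z : dotv x (y + z) = dotv x y + dotv x z.
Proof. by rewrite dotvC dotvDl !(dotvC x). Qed.

Lemma dotvZr a x y : dotv x (a *: y) = a * dotv x y.
Proof. by rewrite dotvC dotvZl dotvC. Qed.

Lemma dotvNr x y : dotv x (- y) = - dotv x y.
Proof. by rewrite -scaleN1r dotvZr mulN1r. Qed.

Lemma dotvNl x y : dotv (- x) y = - dotv x y.
Proof. by rewrite dotvC dotvNr dotvC. Qed.

Lemma dotvBr x y z : dotv x (y - z) = dotv x y - dotv x z.
Proof. by rewrite dotvDr dotvNr. Qed.

Lemma dotvBl x y z : dotv (x - y) z = dotv x z - dotv y z.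
Proof. by rewrite dotvDl dotvNl. Qed.

Lemma dot0v x : dotv 0 x = 0.
Proof. by rewrite -(scale0r x) dotvZl mul0r. Qed.

Lemma dotv_ge0 x : 0 <= dotv x x.
Proof. by apply: sumr_ge0 => i _; rewrite -expr2 sqr_ge0. Qed.

Lemma enorm_ge0 x : 0 <= enorm x.
Proof. exact: sqrtr_ge0. Qed.

Lemma sqr_enorm x : enorm x ^+ 2 = dotv x x.
Proof. by rewrite sqr_sqrtr// dotv_ge0. Qed.

Lemma enormZ a x : enorm (a *: x) = `|a| * enorm x.
Proof.
by rewrite /enorm dotvZl dotvZr mulrA -expr2 sqrtrM ?sqr_ge0// sqrtr_sqr.
Qed.

Lemma enormN x : enorm (- x) = enorm x.
Proof. by rewrite -scaleN1r enormZ normrN1 mul1r. Qed.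

Lemma enorm0 : enorm (0 : 'rV[R]_N) = 0.
Proof. by rewrite /enorm dot0v sqrtr0. Qed.

Lemma enorm_eq0 x : (enorm x == 0) = (x == 0).
Proof.
apply/eqP/eqP => [x0|->]; last exact: enorm0.
have := sqr_enorm x; rewrite x0 expr0n/= => /esym/eqP.
rewrite psumr_eq0 => [/allP H|i _]; last by rewrite -expr2 sqr_ge0.
apply/rowP => i; have /(_ (mem_index_enum _)) := H i.
by rewrite /= mulf_eq0 orbb mxE => /eqP.
Qed.

Lemma enorm_coord x i : `|x ord0 i| <= enorm x.
Proof.
rewrite -ler_sqr ?nnegrE ?enorm_ge0// sqr_enorm /dotv (bigD1 i)//=.
rewrite real_normK ?num_real// -expr2 lerDl.
by apply: sumr_ge0 => j _; rewrite -expr2 sqr_ge0.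
Qed.

(** The square of the norm of |y|^2 x - (x . y) y is nonnegative. *)
Lemma dotv_le x y : dotv x y <= enorm x * enorm y.
Proof.
have [->|y0] := eqVneq y 0; first by rewrite dotvC dot0v mulr_ge0 ?enorm_ge0.
have Y0 : 0 < dotv y y by rewrite -sqr_enorm exprn_gt0// lt_def enorm_eq0 y0 enorm_ge0.
apply: le_trans (ler_norm _) _.
rewrite -ler_sqr ?nnegrE ?mulr_ge0 ?enorm_ge0// real_normK ?num_real//.
rewrite exprMn !sqr_enorm -(ler_pM2l Y0).
have := dotv_ge0 (dotv y y *: x - dotv x y *: y).
rewrite dotvBr !dotvBl !dotvZr !dotvZl (dotvC y x).
nra.
Qed.

Lemma dotv_abs x y : `|dotv x y| <= enorm x * enorm y.
Proof.
rewrite ler_norml dotv_le andbT lerNl -dotvNl.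
by rewrite -(enormN x) dotv_le.
Qed.

Lemma enormD x y : enorm (x + y) <= enorm x + enorm y.
Proof.
rewrite -ler_sqr ?nnegrE ?addr_ge0 ?enorm_ge0// sqr_enorm sqrrD !sqr_enorm.
rewrite dotvDr !dotvDl (dotvC y x) mulr2n; have := dotv_le x y; lra.
Qed.

Lemma enorm_sum_coord x : enorm x <= \sum_(i < N) `|x ord0 i|.
Proof.
have s0 : 0 <= \sum_(i < N) `|x ord0 i| by exact: sumr_ge0.
rewrite -ler_sqr ?nnegrE ?enorm_ge0// sqr_enorm expr2 mulr_suml.
apply: ler_sum => i _; rewrite -expr2 -real_normK ?num_real// expr2.
by rewrite ler_wpM2l// (bigD1 i)//= lerDl sumr_ge0.
Qed.

Lemma enorm_parallelogram x y :
  enorm (x - y) ^+ 2 =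
  2 * enorm x ^+ 2 + 2 * enorm y ^+ 2 - 4 * enorm (2^-1 *: (x + y)) ^+ 2.
Proof.
rewrite !sqr_enorm !(dotvZl, dotvZr, dotvBr, dotvDr, dotvBl, dotvDl) (dotvC y x).
by field.
Qed.

End euclidean_norm.

(** * Convexity of powers of the Euclidean norm *)
Section vector_powers.
Context {R : realType} {N : nat}.
Implicit Types (x y : 'rV[R]_N) (p q : R).

(** The vector p |x|^(p-2) x is the gradient of |.|^p at x.  Cauchy-Schwarz reduces
    the inequality to the scalar one; at x = 0 it reduces to 0 <= |y|^p. *)
Lemma enorm_powR_tangent x y p : 1 < p ->
  enorm x `^ p + p * (enorm x `^ (p - 2) * dotv x (y - x)) <= enorm y `^ p.
Proof.
move=> p1; have p0 : 0 < p := lt_trans ltr01 p1.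
have [->|x0] := eqVneq x 0.
  by rewrite dot0v !mulr0 enorm0 powR0 ?gt_eqF// addr0 powR_ge0.
have X0 : 0 < enorm x by rewrite lt_def enorm_eq0 x0 enorm_ge0.
have E1 : enorm x `^ (p - 2) * dotv x x = enorm x `^ p.
  rewrite -sqr_enorm -powR_mulrn ?enorm_ge0// -gt0_powRD//.
  by congr (_ `^ _); ring.
have E2 : enorm x `^ (p - 2) * enorm x = enorm x `^ (p - 1).
  rewrite -[X in _ * X]powRr1 ?enorm_ge0// -gt0_powRD//.
  by congr (_ `^ _); ring.
have := young_powR p1 (enorm_ge0 x) (enorm_ge0 y).
have : p * (enorm x `^ (p - 2) * dotv x y) <=
       p * (enorm x `^ (p - 2) * (enorm x * enorm y)).
  by rewrite ler_pM2l// ler_wpM2l ?powR_ge0// dotv_le.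
rewrite (mulrA (_ `^ (p - 2))) E2 dotvBr mulrBr E1 (mulrA p (_ `^ (p - 1))); lra.
Qed.

(** The Young inequality between m and s has a uniform gap as long as m stays
    below a fixed fraction of s.  With m = s exp(-x), the gap divided by s^p is
    at least 1 - (1 + y) exp(-y) for y = (p - 1) x, and this is increasing in
    y. *)
Lemma young_powR_gap p (mu : R) : 1 < p -> 0 < mu < 1 ->
  exists2 delta : R, 0 < delta & forall s m : R, 0 <= s -> 0 <= m -> m <= mu * s ->
    p * m `^ (p - 1) * s + delta * s `^ p <= (p - 1) * m `^ p + s `^ p.
Proof.
move=> p1 /andP[mu0 mu1]; have p0 : 0 < p := lt_trans ltr01 p1.
pose y0 := (p - 1) * - ln mu.
have y0_gt0 : 0 < y0.
  by rewrite mulr_gt0 ?subr_gt0// oppr_gt0 -ln1 ltr_ln ?posrE.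
exists (1 - (1 + y0) * expR (- y0)).
  rewrite subr_gt0 expRN -ltr_pdivlMr ?invr_gt0 ?expR_gt0// invrK mul1r.
  by rewrite expR_gt1Dx// gt_eqF.
move=> s m; rewrite le_eqVlt => /predU1P[<-|s0].
  rewrite mulr0 => m0 m0'; have -> : m = 0 by apply/eqP; rewrite eq_le m0 m0'.
  by rewrite !powR0 ?subr_eq0 ?gt_eqF// !mulr0.
set delta := 1 - (1 + y0) * _.
have delta1 : delta <= 1.
  by rewrite gerBl mulr_ge0 ?expR_ge0// addr_ge0// ltW.
rewrite le_eqVlt => /predU1P[<- _|m0 msmu].
  rewrite !powR0 ?subr_eq0 ?gt_eqF// !mulr0 mul0r !add0r.
  by rewrite ler_piMl// powR_ge0.
have sE : s = expR (ln s) by rewrite lnK// posrE.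
have yE : ln m <= ln mu + ln s by rewrite -lnM ?posrE// ler_ln ?posrE// mulr_gt0.
rewrite !gt0_powRE//; set u := ln m in yE *; set v := ln s in yE sE *.
rewrite [X in _ * X + _]sE.
set y := (p - 1) * (v - u).
have yy0 : y0 <= y by rewrite /y0 /y ler_pM2l ?subr_gt0//; lra.
have -> : p * u = p * v + (- y - (v - u)) by rewrite /y; ring.
have -> : (p - 1) * u = (p * v + - y) - v by rewrite /y; ring.
rewrite !expRD !expRN.
set e := expR (p * v); set E := expR y.
have e0 : 0 < e by exact: expR_gt0.
have E0 : 0 < E by exact: expR_gt0.
have h1 : 1 - (v - u) <= (expR (v - u))^-1 by rewrite -expRN; exact: expR_ge1Dx.
set F := (expR (v - u))^-1 in h1 *.
have h2 : (1 + y) / E <= (1 + y0) * expR (- y0).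
  rewrite ler_pdivrMr// -mulrA /E -expRD.
  have := expR_ge1Dx (- y0 + y); set G := expR (- y0 + y).
  have : 0 <= y - y0 by rewrite subr_ge0.
  nra.
rewrite [X in X <= _](_ : _ = e * (p / E + delta)); last first.
  by rewrite /e; field; rewrite !gt_eqF ?expR_gt0.
rewrite [X in _ <= X](_ : _ = e * ((p - 1) * F / E + 1)); last first.
  by field; rewrite gt_eqF.
rewrite ler_pM2l//.
have : (p - 1) * (1 - (v - u)) / E <= (p - 1) * F / E.
  by rewrite ler_pM2r ?invr_gt0// ler_pM2l ?subr_gt0.
have -> : (p - 1) * (1 - (v - u)) / E = (p / E) - (1 + y) / E.
  by rewrite /y; field; rewrite gt_eqF.
rewrite /delta; lra.
Qed.

(** Let |y| <= |x| = s and let m be the norm of the midpoint.  If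
    |x - y|^2 <= k s^2 with k small, the first term suffices.  Otherwise the
    parallelogram identity forces m <= mu s for a fixed mu < 1; then the
    convexity defect, written as the sum of the Young defects of (m, |x|) and
    (m, |y|) and of a multiple of |x| + |y| - 2 m, is bounded below by a
    multiple of s^q through the first of them. *)
Lemma enorm_powR_uniform_convex q (eps : R) : 1 < q -> 0 < eps ->
  exists2 C : R, 0 <= C & forall x y,
    enorm (x - y) `^ q <= eps * (enorm x `^ q + enorm y `^ q) +
      C * ((enorm x `^ q + enorm y `^ q) / 2 - enorm (2^-1 *: (x + y)) `^ q).
Proof.
move=> q1 eps0; have q0 : 0 < q := lt_trans ltr01 q1.
pose k := Num.min 1 (eps `^ (2 / q)).
have k0 : 0 < k by rewrite lt_min ltr01/= powR_gt0.
have k1 : k <= 1 by rewrite ge_min lexx.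
have keps : k `^ (q / 2) <= eps.
  rewrite [X in _ <= X](_ : eps = (eps `^ (2 / q)) `^ (q / 2)).
    apply: ge0_ler_powR; rewrite ?nnegrE ?powR_ge0// ?(ltW k0)//.
      by rewrite divr_ge0// ltW.
    by rewrite ge_min lexx orbT.
  rewrite -powRrM (_ : _ * _ = 1) ?powRr1// ?(ltW eps0)//.
  by field; rewrite gt_eqF.
pose mu := Num.sqrt (1 - k / 4).
have mu01 : 0 < mu < 1.
  rewrite sqrtr_gt0; apply/andP; split; first lra.
  by rewrite -[X in _ < X]sqrtr1 ltr_sqrt//; lra.
have [delta delta0 gap] := young_powR_gap q1 mu01.
exists (2 `^ q * (2 / delta)); first by rewrite mulr_ge0 ?powR_ge0// divr_ge0// ltW.
suff H x y : enorm y <= enorm x -> 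
    enorm (x - y) `^ q <= eps * (enorm x `^ q + enorm y `^ q) +
      (2 `^ q * (2 / delta)) *
      ((enorm x `^ q + enorm y `^ q) / 2 - enorm (2^-1 *: (x + y)) `^ q).
  move=> x y; case/orP: (le_total (enorm y) (enorm x)) => [|yx]; first exact: H.
  rewrite -opprB enormN (addrC x) (addrC (enorm x `^ q)); exact: H.
set C := _ * (2 / delta); have CE : C = 2 `^ q * (2 / delta) by [].
have C0 : 0 <= C by rewrite mulr_ge0 ?powR_ge0// divr_ge0// ltW.
move=> yx.
set s := enorm x in yx *; set t := enorm y in yx *; set m := enorm (2^-1 *: _).
have s0 : 0 <= s by exact: enorm_ge0.
have t0 : 0 <= t by exact: enorm_ge0.
have m0 : 0 <= m by exact: enorm_ge0.
have mst : m <= (s + t) / 2.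
  by rewrite /m enormZ ger0_norm// mulrC ler_pM2r ?invr_gt0// enormD.
have dE := enorm_parallelogram x y; rewrite -/s -/t -/m in dE.
have dst : enorm (x - y) <= s + t by apply: le_trans (enormD _ _) _; rewrite enormN.
move: (enorm (x - y)) (enorm_ge0 (x - y)) dE dst => e e_ge0 dE dst.
clearbody C s t m.
have defect0 : m `^ q <= (s `^ q + t `^ q) / 2.
  apply: le_trans (powR_midpoint q1 s0 t0).
  by apply: ge0_ler_powR; rewrite ?nnegrE ?(ltW q0)// divr_ge0// addr_ge0.
have sq0 : 0 <= s `^ q by exact: powR_ge0.
have tq0 : 0 <= t `^ q by exact: powR_ge0.
have [small|large] := leP (e ^+ 2) (k * s ^+ 2).
  have : e `^ q <= eps * s `^ q.
    have -> : e `^ q = (e ^+ 2) `^ (q / 2).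
      rewrite -powR_mulrn// -powRrM; congr (_ `^ _); by field.
    apply: (@le_trans _ _ ((k * s ^+ 2) `^ (q / 2))).
      apply: ge0_ler_powR; rewrite ?nnegrE ?exprn_ge0//.
        by rewrite divr_ge0// ltW.
      by rewrite mulr_ge0 ?exprn_ge0// ltW.
    rewrite powRM ?(ltW k0) ?exprn_ge0//.
    have -> : (s ^+ 2) `^ (q / 2) = s `^ q.
      rewrite -powR_mulrn// -powRrM; congr (_ `^ _); by field.
    by rewrite ler_wpM2r.
  have := mulr_ge0 C0 (_ : 0 <= (s `^ q + t `^ q) / 2 - m `^ q).
  rewrite subr_ge0 => /(_ defect0).
  have : 0 <= eps * t `^ q by rewrite mulr_ge0// ltW.
  lra.
have mu2 : mu ^+ 2 = 1 - k / 4 by rewrite sqr_sqrtr//; lra.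
have mmus : m <= mu * s.
  rewrite -ler_sqr ?nnegrE// ?mulr_ge0// ?sqrtr_ge0// exprMn mu2.
  rewrite dE in large.
  have : t ^+ 2 <= s ^+ 2 by rewrite ler_sqr ?nnegrE.
  nra.
have {gap}g1 := gap s m s0 m0 mmus.
have g2 := young_powR q1 m0 t0.
have mqE : m * m `^ (q - 1) = m `^ q by rewrite mulr_powRB1.
have m1q0 : 0 <= m `^ (q - 1) by exact: powR_ge0.
have g3 : 0 <= q * m `^ (q - 1) * (s + t - 2 * m).
  by rewrite mulr_ge0 ?mulr_ge0 ?(ltW q0)// subr_ge0; lra.
have defect : delta * s `^ q <= 2 * ((s `^ q + t `^ q) / 2 - m `^ q).
  have : q * m `^ (q - 1) * (2 * m) = 2 * q * m `^ q by rewrite -mqE; ring.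
  lra.
have : e `^ q <= 2 `^ q * s `^ q.
  rewrite -powRM//; apply: ge0_ler_powR; rewrite ?nnegrE ?mulr_ge0 ?(ltW q0)//.
  by lra.
have : 2 `^ q * s `^ q <= C * ((s `^ q + t `^ q) / 2 - m `^ q).
  rewrite CE -mulrA ler_pM2l ?powR_gt0// mulrAC ler_pdivlMr// mulrC; exact: defect.
have : 0 <= eps * (s `^ q + t `^ q) by rewrite mulr_ge0 ?addr_ge0// ltW.
lra.
Qed.

End vector_powers.

(** * Measurable vector fields of class L^q *)
Section vector_fields.
Context d (T : measurableType d) (R : realType) (N : nat).
Variables (D : set T).
Hypothesis mD : measurable D.
Implicit Types (F G : T -> 'rV[R]_N) (w : T -> R).

Lemma measurable_rV_within F :
  measurable_fun D F <-> forall i, measurable_fun D (fun x => F x ord0 i).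
Proof.
split=> [mF i|mF].
  by apply: (measurableT_comp (measurable_rV_coord i) mF).
have sub : g_sigma_preimage (@rV_coord _ R N) `<=`
    [set B | measurable (D `&` F @^-1` B)].
  apply: smallest_sub.
    split=> [|B /= mB|A /= mA].
    - by rewrite /= preimage_set0 setI0.
    - rewrite setTD -preimage_setC -setDE.
      have -> : D `\` F @^-1` B = D `\` (D `&` F @^-1` B).
        by rewrite setDIr setDv set0U.
      exact: measurableD.
    - by rewrite preimage_bigcup setI_bigcupr; exact: bigcup_measurable.
  rewrite -bigcup_seq => B [i _ [C mC <-]] /=.
  by rewrite setTI; exact: mF.
by move=> _ B mB; exact: sub.
Qed.

Lemma measurable_fun_dotv F G : measurable_fun D F -> measurable_fun D G ->
  measurable_fun D (fun x => dotv (F x) (G x)).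
Proof.
move=> /measurable_rV_within mF /measurable_rV_within mG.
by apply: measurable_sum => i; exact: measurable_funM.
Qed.

Lemma measurable_fun_enorm F : measurable_fun D F ->
  measurable_fun D (fun x => enorm (F x)).
Proof.
move=> mF; apply: (@measurableT_comp _ _ _ _ _ _ (@Num.sqrt R)).
  by apply: continuous_measurable_fun; exact: sqrt_continuous.
exact: measurable_fun_dotv.
Qed.

Lemma measurable_fun_enorm_powR F p : measurable_fun D F ->
  measurable_fun D (fun x => enorm (F x) `^ p).
Proof.
move=> mF; apply: (@measurableT_comp _ _ _ _ _ _ (@powR R ^~ p)).
  exact: measurable_powR.
exact: measurable_fun_enorm.
Qed.

Lemma measurable_fun_rVD F G : measurable_fun D F -> measurable_fun D G ->
  measurable_fun D (fun x => F x + G x).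
Proof.
move=> /measurable_rV_within mF /measurable_rV_within mG.
apply/measurable_rV_within => i; under eq_fun do rewrite mxE.
exact: measurable_funD.
Qed.

Lemma measurable_fun_rVZ w F : measurable_fun D w -> measurable_fun D F ->
  measurable_fun D (fun x => w x *: F x).
Proof.
move=> mw /measurable_rV_within mF.
apply/measurable_rV_within => i; under eq_fun do rewrite mxE.
exact: measurable_funM.
Qed.

Lemma measurable_fun_rVB F G : measurable_fun D F -> measurable_fun D G ->
  measurable_fun D (fun x => F x - G x).
Proof.
move=> mF mG; apply: measurable_fun_rVD => //.
rewrite (_ : (fun x => _) = (fun x => -1 *: G x)); last first.
  by apply/funext => x; rewrite scaleN1r.
exact: measurable_fun_rVZ.
Qed.

End vector_fields.

Section Lq_fields.
Context d (T : measurableType d) (R : realType) (N : nat).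
Variables (mu : {measure set T -> \bar R}) (D : set T).
Hypothesis mD : measurable D.
Hypothesis Doo : (mu D < +oo)%E.
Implicit Types (F G : T -> 'rV[R]_N) (w : T -> R) (p q : R).

Definition Lq_field q F := measurable_fun D F /\
  mu.-integrable D (EFin \o (fun x => enorm (F x) `^ q)).

Lemma Lq_fieldD q F G : 0 <= q -> Lq_field q F -> Lq_field q G ->
  Lq_field q (fun x => F x + G x).
Proof.
move=> q0 [mF IF] [mG IG]; split; first exact: measurable_fun_rVD.
apply: (@ae_dominated_integrable _ _ _ _ _ mD _
  (fun x => 2 `^ q * (enorm (F x) `^ q + enorm (G x) `^ q))).
- by apply: measurable_fun_enorm_powR => //; exact: measurable_fun_rVD.
- apply: nearW => x Dx; rewrite ger0_norm ?powR_ge0//.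
  apply: le_trans (powR_add_le q0 (enorm_ge0 _) (enorm_ge0 _)).
  by apply: ge0_ler_powR; rewrite ?nnegrE ?addr_ge0 ?enorm_ge0// enormD.
- by apply: integrable_EFinZ => //; exact: integrable_EFinD.
Qed.

Lemma Lq_fieldZ q (a : R) F : Lq_field q F -> Lq_field q (fun x => a *: F x).
Proof.
move=> [mF IF]; split; first exact: measurable_fun_rVZ.
rewrite (_ : (fun x => _) = fun x => `|a| `^ q * enorm (F x) `^ q).
  exact: integrable_EFinZ.
by apply/funext => x; rewrite enormZ powRM// enorm_ge0.
Qed.

Lemma Lq_fieldB q F G : 0 <= q -> Lq_field q F -> Lq_field q G ->
  Lq_field q (fun x => F x - G x).
Proof.
move=> q0 LF LG; have := Lq_fieldD q0 LF (Lq_fieldZ (-1) LG).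
by rewrite (_ : (fun x => _) = fun x => F x - G x)//; apply/funext => x; rewrite scaleN1r.
Qed.

Lemma integrable_enorm q F : 1 < q -> Lq_field q F ->
  mu.-integrable D (EFin \o (fun x => enorm (F x))).
Proof.
move=> q1 [mF IF].
apply: (@ae_dominated_integrable _ _ _ _ _ mD _
  (fun x => (q - 1) * 1 + enorm (F x) `^ q)).
- exact: measurable_fun_enorm.
- apply: nearW => x Dx; rewrite ger0_norm ?enorm_ge0//.
  have := young_powR q1 ler01 (enorm_ge0 (F x)).
  rewrite !powR1 !mulr1; apply: le_trans.
  by rewrite ler_peMl ?enorm_ge0// ltW.
- apply: integrable_EFinD => //; exact: (integrable_cst_fun mD ((q - 1) * 1) Doo).
Qed.

Lemma integrable_dotv p q F G : 1 < p -> q = p / (p - 1) ->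
  Lq_field p F -> Lq_field q G ->
  mu.-integrable D (EFin \o (fun x => dotv (F x) (G x))).
Proof.
move=> p1 qE [mF IF] [mG IG].
have p10 : 0 < p - 1 by rewrite subr_gt0.
have p0 : 0 < p := lt_trans ltr01 p1.
apply: (@ae_dominated_integrable _ _ _ _ _ mD _
  (fun x => p^-1 * enorm (F x) `^ p + q^-1 * enorm (G x) `^ q)).
- exact: measurable_fun_dotv.
- apply: nearW => x Dx; apply: le_trans (dotv_abs _ _) _.
  rewrite (mulrC p^-1) (mulrC q^-1).
  apply: conjugate_powR; rewrite ?enorm_ge0// qE ?divr_gt0//.
  by field; rewrite !gt_eqF.
- by apply: integrable_EFinD => //; exact: integrable_EFinZ.
Qed.

End Lq_fields.

Lemma cvg_dotv (R : realType) (N : nat) (F G : nat -> 'rV[R]_N) (x y : 'rV[R]_N) :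
  (forall i, (fun n => F n ord0 i) @ \oo --> x ord0 i) ->
  (forall i, (fun n => G n ord0 i) @ \oo --> y ord0 i) ->
  (fun n => dotv (F n) (G n)) @ \oo --> dotv x y.
Proof.
by move=> Fx Gy; apply: cvg_big => [|i _]; [exact: add_continuous|exact: cvgM].
Qed.

Lemma cvg_enorm (R : realType) (N : nat) (F : nat -> 'rV[R]_N) (x : 'rV[R]_N) :
  (forall i, (fun n => F n ord0 i) @ \oo --> x ord0 i) ->
  (fun n => enorm (F n)) @ \oo --> enorm x.
Proof.
by move=> Fx; apply: (cvg_comp _ _ (cvg_dotv Fx Fx)); exact: sqrt_continuous.
Qed.

(** * Sequences of vector fields with summable steps *)
Section fast_cauchy.
Context d (T : measurableType d) (R : realType) (N : nat).
Variables (mu : {measure set T -> \bar R}) (D : set T).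
Hypothesis mD : measurable D.
Variables (F : nat -> T -> 'rV[R]_N) (K : R).
Hypothesis mF : forall k, measurable_fun D (F k).
Hypothesis IF0 : mu.-integrable D (EFin \o (fun x => enorm (F 0%N x))).
Let del k x := enorm (F k.+1 x - F k x).
Hypothesis Idel : forall k, mu.-integrable D (EFin \o del k).
Hypothesis ledel : forall k, \int[mu]_(x in D) del k x <= K / (2 ^ k.+1)%:R.

Let S x : \bar R := (\sum_(0 <= k <oo) (del k x)%:E)%E.

Let mdel k : measurable_fun D (EFin \o del k).
Proof. exact: (measurable_int mu (Idel k)). Qed.

Let del_ge0 k x : 0 <= del k x.
Proof. exact: enorm_ge0. Qed.

Let S_ge0 x : (0 <= S x)%E.
Proof. by apply: nneseries_ge0 => k _ _; rewrite lee_fin. Qed.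

Let mS : measurable_fun D S.
Proof.
rewrite /S; apply: ge0_emeasurable_sum; last by move=> k _; exact: mdel.
by move=> k x Dx _; rewrite lee_fin.
Qed.

Let IS : mu.-integrable D S.
Proof.
apply/integrableP; split=> //.
under eq_integral => x _ do rewrite gee0_abs//.
rewrite integral_nneseries//; last by move=> k x _; rewrite lee_fin.
apply: (@le_lt_trans _ _ (\sum_(0 <= k <oo) (K / (2 ^ (k + 1))%:R)%:E)%E).
  apply: lee_nneseries => [k _ _|k _].
    by apply: integral_ge0 => x _; rewrite lee_fin.
  by rewrite EFin_Rintegral// lee_fin addn1.
have /cvg_lim := @cvg_geometric_eseries_half R K 0.
rewrite /eseries/= => -> //.
by rewrite ltry.
Qed.

(** The sum S of the norms of the steps is integrable, hence finite almost
    everywhere; there the coordinates form absolutely convergent series, and the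
    norm of the first field plus S dominates the sequence. *)
Lemma fast_cauchy_limit : exists (G : T -> 'rV[R]_N) (g : T -> R),
  [/\ measurable_fun D G, mu.-integrable D (EFin \o g),
   {ae mu, forall x, D x -> forall i, (fun k => F k x ord0 i) @ \oo --> G x ord0 i} &
   {ae mu, forall x, D x -> forall k, enorm (F k x) <= g x}].
Proof.
(* an upper limit is measurable without any convergence assumption *)
pose G x : 'rV[R]_N := \row_i fine (limn_esup (fun k => (F k x ord0 i)%:E)).
have mfine : measurable_fun D (fine \o S).
  apply: measurableT_comp => //; exact: fine_measurable.
exists G, (fun x => enorm (F 0%N x) + fine (S x)); split.
- apply/measurable_rV_within => //= i; under eq_fun do rewrite mxE.
  apply: measurableT_comp; first exact: fine_measurable.
  apply: measurable_fun_limn_esup => k; apply/measurable_EFinP.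
  by have /(measurable_rV_within mD) := mF k; exact.
- apply: (integrable_EFinD mD IF0).
  apply: (le_integrable mD _ _ IS) => [|x Dx /=]; first exact/measurable_EFinP.
  by have := S_ge0 x; case: (S x) => [r| |] //= r0; rewrite leey.
- apply: filterS (integrable_ae mD IS) => x + Dx => /(_ Dx) Sfin i.
  have cF : cvgn (fun k => F k x ord0 i).
    have cdel : cvgn (series (del ^~ x)).
      by apply: nnseries_is_cvg => //; rewrite -/(S x) ltey_eq Sfin.
    have cd : cvgn (series (fun k => F k.+1 x ord0 i - F k x ord0 i)).
      apply: normed_cvg; apply: series_le_cvg cdel => [k|k|k].
      - exact: normr_ge0.
      - exact: enorm_ge0.
      by rewrite /del/=; have := enorm_coord (F k.+1 x - F k x) i; rewrite !mxE.
    rewrite (_ : (fun k => _) = (fun k => F 0%N x ord0 i +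
      series (fun k => F k.+1 x ord0 i - F k x ord0 i) k)).
      by apply/cvg_ex; eexists; apply: cvgD; [exact: cvg_cst|exact: cd].
    apply/funext => k; rewrite /series/= telescope_sumr//; ring.
  rewrite /G mxE.
  have cE : (F k x ord0 i)%:E @[k --> \oo] --> (limn (fun k => F k x ord0 i))%:E.
    by apply: cvg_comp cF _ => //; exact: cvg_refl.
  by rewrite (cvg_limn_einf_sup cE).2.
- apply: filterS (integrable_ae mD IS) => x + Dx => /(_ Dx) Sfin k.
  have : \sum_(0 <= j < k) del j x <= fine (S x).
    rewrite -lee_fin fineK// -sumEFin; apply: nneseries_lim_ge => j _ _.
    by rewrite lee_fin.
  rewrite -(lerD2l (enorm (F 0%N x))); apply: le_trans.
  elim: k => [|k IHk]; first by rewrite big_geq// addr0.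
  rewrite big_nat_recr//= addrA -[in X in enorm X](subrK (F k x) (F k.+1 x)).
  by apply: le_trans (enormD _ _) _; rewrite addrC; apply: lerD.
Qed.

End fast_cauchy.

(** * Minimisation of a weighted energy *)

(** The definition is locked to keep integrals of different fields from being
    compared by unfolding. *)
HB.lock Definition weighted_energy d (T : measurableType d) (R : realType)
    (N : nat) (mu : {measure set T -> \bar R}) (D : set T) (q : R)
    (w : T -> R) (F : T -> 'rV[R]_N) : R :=
  \int[mu]_(x in D) (w x * enorm (F x) `^ q).

Section weighted_energy.
Context d (T : measurableType d) (R : realType) (N : nat).
Variables (mu : {measure set T -> \bar R}) (D : set T).
Hypothesis mD : measurable D.
Hypothesis Doo : (mu D < +oo)%E.
Variables (q : R) (w : T -> R) (W : R).
Hypothesis q1 : 1 < q.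
Hypothesis mw : measurable_fun D w.
Hypothesis wW : forall x, D x -> 1 <= w x <= W.
Implicit Types (F G : T -> 'rV[R]_N).
Local Notation Lq := (@Lq_field _ T R N mu D q).

Let q0 : 0 < q := lt_trans ltr01 q1.
Let q_ge0 : 0 <= q := ltW q0.

Local Notation wenergy := (@weighted_energy _ T R N mu D q w).

Lemma wenergyE F : wenergy F = \int[mu]_(x in D) (w x * enorm (F x) `^ q).
Proof. by rewrite unlock. Qed.

Lemma measurable_wdensity F : measurable_fun D F ->
  measurable_fun D (fun x => w x * enorm (F x) `^ q).
Proof. by move=> mF; apply: measurable_funM => //; exact: measurable_fun_enorm_powR. Qed.

Lemma integrable_wdensity F : Lq F ->
  mu.-integrable D (EFin \o (fun x => w x * enorm (F x) `^ q)).
Proof.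
move=> [mF IF]; apply: (ae_dominated_integrable mD _ _ (integrable_EFinZ mD W IF)).
  exact: measurable_wdensity.
apply: nearW => x Dx; have /andP[w1 wW'] := wW Dx.
by rewrite ger0_norm ?mulr_ge0 ?powR_ge0 ?(le_trans ler01)// ler_wpM2r// powR_ge0.
Qed.

Lemma wenergy_ge0 F : 0 <= wenergy F.
Proof.
rewrite wenergyE; apply: Rintegral_ge0 => x Dx; have /andP[w1 _] := wW Dx.
by rewrite mulr_ge0 ?powR_ge0// (le_trans ler01).
Qed.

Lemma Lq_mid F G : Lq F -> Lq G -> Lq (fun x => 2^-1 *: (F x + G x)).
Proof. by move=> LF LG; exact: (Lq_fieldZ mD 2^-1 (Lq_fieldD mD q_ge0 LF LG)). Qed.

(** The pointwise inequality [enorm_powR_uniform_convex], integrated against the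
    weight w. *)
Lemma wenergy_uniform_convex (eps : R) : 0 < eps -> exists2 C : R, 0 <= C &
  forall F G, Lq F -> Lq G ->
    wenergy (fun x => F x - G x) <= eps * (wenergy F + wenergy G) +
      C * ((wenergy F + wenergy G) / 2 - wenergy (fun x => 2^-1 *: (F x + G x))).
Proof.
move=> eps0; have [C C0 UC] := @enorm_powR_uniform_convex R N q eps q1 eps0.
exists C => // F G LF LG.
have IF := integrable_wdensity LF; have IG := integrable_wdensity LG.
have IM := integrable_wdensity (Lq_mid LF LG).
have ID := integrable_wdensity (Lq_fieldB mD q_ge0 LF LG).
have IS := integrable_EFinD mD IF IG.
have IS2 := integrable_EFinZ mD 2^-1 IS.
have IB := integrable_EFinB mD IS2 IM.
have I1 := integrable_EFinZ mD eps IS.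
have I2 := integrable_EFinZ mD C IB.
have -> : eps * (wenergy F + wenergy G) +
    C * ((wenergy F + wenergy G) / 2 - wenergy (fun x => 2^-1 *: (F x + G x))) =
    \int[mu]_(x in D) (eps * (w x * enorm (F x) `^ q + w x * enorm (G x) `^ q) +
      C * (2^-1 * (w x * enorm (F x) `^ q + w x * enorm (G x) `^ q) -
           w x * enorm (2^-1 *: (F x + G x)) `^ q)).
  rewrite !wenergyE (RintegralD mD I1 I2) (RintegralZl _ mD IS) (RintegralZl _ mD IB).
  by rewrite (RintegralB mD IS2 IM) (RintegralZl _ mD IS) (RintegralD mD IF IG) [2^-1 * _]mulrC.
rewrite wenergyE; apply: le_Rintegral => //; first exact: (integrable_EFinD mD I1 I2).
move=> x Dx; have /andP[w1 _] := wW Dx.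
have w0 : 0 <= w x by exact: le_trans w1.
have := ler_wpM2l w0 (UC (F x) (G x)).
move: (enorm _ `^ q) (enorm _ `^ q) (enorm _ `^ q) (enorm _ `^ q) => a e l m.
move: (w x) => v; lra.
Qed.

(** If neither energy exceeds that of the midpoint, the convexity defect in
    [wenergy_uniform_convex] is nonpositive, and the energy of F - G is at most
    eps times a constant for every eps. *)
Lemma wenergy_minimizer_unique F G : Lq F -> Lq G ->
  wenergy F <= wenergy (fun x => 2^-1 *: (F x + G x)) ->
  wenergy G <= wenergy (fun x => 2^-1 *: (F x + G x)) ->
  {ae mu, forall x, D x -> F x = G x}.
Proof.
move=> LF LG; set M := wenergy (fun x => 2^-1 *: _) => FM GM.
have LD := Lq_fieldB mD q_ge0 LF LG.
have le0 : wenergy (fun x => F x - G x) <= 0.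
  apply/ler_addgt0Pr => e e0; rewrite add0r.
  have [s [s0 sM UC]] : exists s : R, [/\ 0 <= s, s <= 2 * M &
      forall eps : R, 0 < eps -> exists2 C : R, 0 <= C &
        wenergy (fun x => F x - G x) <= eps * s + C * (s / 2 - M)].
    exists (wenergy F + wenergy G); split; first by rewrite addr_ge0 ?wenergy_ge0.
      by rewrite mulrC mulr_natr mulr2n lerD.
    by move=> eps /wenergy_uniform_convex[C C0 UC]; exists C => //; exact: UC.
  have [|C C0 {}UC] := UC (e / (s + 1)).
    by rewrite divr_gt0// ltr_wpDl.
  clearbody M; apply: le_trans UC _.
  have Y0 : C * (s / 2 - M) <= 0 by apply: mulr_ge0_le0 => //; lra.
  have Z0 : e / (s + 1) * s <= e.
    by rewrite mulrAC ler_pdivrMr ?ltr_wpDl// ler_pM2l// lerDl.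
  by rewrite -[X in _ <= X]addr0; exact: lerD.
rewrite wenergyE in le0.
have := Rintegral_le0_ae0 mD (integrable_wdensity LD) _ le0.
have pos x : D x -> 0 <= w x * enorm (F x - G x) `^ q.
  move=> Dx; have /andP[w1 _] := wW Dx.
  by rewrite mulr_ge0 ?powR_ge0// (le_trans ler01).
move=> /(_ pos); apply: filterS => x + Dx => /(_ Dx)/eqP.
have /andP[w1 _] := wW Dx.
rewrite mulf_eq0 gt_eqF/= ?(lt_le_trans ltr01)//.
by rewrite powR_eq0 enorm_eq0 subr_eq0 => /andP[/eqP].
Qed.

(** The form of closedness provided by the sequences of [fast_cauchy_limit]; it
    is preserved by linear constraints given by bounded fields, through
    dominated convergence. *)
Definition dominated_ae_closed (A : set (T -> 'rV[R]_N)) :=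
  forall (F : nat -> T -> 'rV[R]_N) (G : T -> 'rV[R]_N) (g : T -> R),
    (forall n, A (F n)) -> Lq G -> mu.-integrable D (EFin \o g) ->
    {ae mu, forall x, D x -> forall i, (fun n => F n x ord0 i) @ \oo --> G x ord0 i} ->
    {ae mu, forall x, D x -> forall n, enorm (F n x) <= g x} -> A G.

(** For each k there is a tolerance below which almost minimisers are at distance
    at most [r k] in L^q.  A minimising sequence whose k-th term respects the
    tolerances of indices k and k - 1 has consecutive terms close enough for
    [fast_cauchy_limit], and Fatou's lemma bounds the energy of its limit by the
    infimum. *)
Lemma wenergy_minimizer (A : set (T -> 'rV[R]_N)) :
  A !=set0 -> A `<=` Lq ->
  (forall F G, A F -> A G -> A (fun x => 2^-1 *: (F x + G x))) ->
  dominated_ae_closed A ->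
  exists2 F, A F & forall G, A G -> wenergy F <= wenergy G.
Proof.
move=> [F0 AF0] AL Amid Acl.
have [m [m0 m_le m_adh]] : exists m : R, [/\ 0 <= m, forall F, A F -> m <= wenergy F &
    forall e : R, 0 < e -> exists2 F, A F & wenergy F < m + e].
  pose E := [set wenergy F | F in A].
  have E0 : E !=set0 by exists (wenergy F0); exists F0.
  have lbE : has_lbound E by exists 0 => _ [F _ <-]; exact: wenergy_ge0.
  exists (inf E); split.
  - by apply: lb_le_inf => // _ [F _ <-]; exact: wenergy_ge0.
  - by move=> F AF; apply: ge_inf => //; exists F.
  - move=> e e0; have [_ [F AF <-] lt] := inf_adherent e0 (conj E0 lbE).
    by exists F.
(* the midpoint has energy at least m, so the convexity defect is at most dl *)
have close (eta : R) : 0 < eta -> exists2 dl : R, 0 < dl & forall F G, A F -> A G ->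
    wenergy F <= m + dl -> wenergy G <= m + dl ->
    wenergy (fun x => F x - G x) <= eta.
  move=> eta0.
  have e0 : 0 < eta / (4 * (m + 1)) by rewrite divr_gt0// mulr_gt0// ltr_wpDl.
  have [C C0 UC] := wenergy_uniform_convex e0.
  have d0 : 0 < eta / (2 * (C + 1)) by rewrite divr_gt0// mulr_gt0// ltr_wpDl.
  exists (Num.min 1 (eta / (2 * (C + 1)))); first by rewrite lt_min ltr01.
  set dl := Num.min _ _ => F G AF AG Fd Gd.
  have d1 : dl <= 1 by rewrite ge_min lexx.
  have d2 : dl <= eta / (2 * (C + 1)) by rewrite ge_min lexx orbT.
  have dl0 : 0 < dl by rewrite lt_min ltr01.
  clearbody dl.
  apply: le_trans (UC _ _ (AL _ AF) (AL _ AG)) _.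
  move: (wenergy (fun x => 2^-1 *: _)) (m_le _ (Amid _ _ AF AG)) => M' M.
  move: (wenergy F) (wenergy G) Fd Gd => a b ad bd.
  have h1 : eta / (4 * (m + 1)) * (a + b) <= eta / 2.
    apply: (@le_trans _ _ (eta / (4 * (m + 1)) * (2 * (m + 1)))).
      by rewrite ler_pM2l//; lra.
    by rewrite le_eqVlt; apply/orP; left; apply/eqP; field; rewrite gt_eqF// ltr_wpDl.
  have h2 : C * ((a + b) / 2 - M') <= C * dl.
    by apply: ler_wpM2l => //; lra.
  have h3 : C * dl <= eta / 2.
    apply: (@le_trans _ _ ((C + 1) * (eta / (2 * (C + 1))))).
      by apply: ler_pM => //; [exact: ltW|rewrite lerDl].
    by rewrite le_eqVlt; apply/orP; left; apply/eqP; field; rewrite gt_eqF// ltr_wpDl.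
  lra.
pose r (k : nat) : R := 1 / (2 ^ k.+1)%:R.
have r0 k : 0 < r k by rewrite /r divr_gt0// ltr0n expn_gt0.
have /choice[dl dlP] : forall k, exists dl, 0 < dl /\ forall F G, A F -> A G ->
    wenergy F <= m + dl -> wenergy G <= m + dl ->
    wenergy (fun x => F x - G x) <= r k `^ q.
  by move=> k; have [|dl ? ?] := close (r k `^ q); [rewrite powR_gt0|exists dl].
(* the terms k and k + 1 must both respect the tolerance [dl k] *)
pose rho k := Num.min (Num.min (dl k) (dl k.-1)) (r k).
have rho0 k : 0 < rho k by rewrite !lt_min r0 (dlP k).1 (dlP k.-1).1.
have /choice[F FP] : forall k, exists F, A F /\ wenergy F < m + rho k.
  by move=> k; have [F AF lt] := m_adh _ (rho0 k); exists F.
have AF k : A (F k) := (FP k).1.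
have LF k : Lq (F k) := AL _ (AF k).
have LD k : Lq (fun x => F k.+1 x - F k x) by exact: Lq_fieldB.
have step k : wenergy (fun x => F k.+1 x - F k x) <= r k `^ q.
  apply: (dlP k).2 => //; apply: le_trans (ltW (FP _).2) _; rewrite lerD2l.
    by rewrite !ge_min lexx orbT.
  by rewrite !ge_min lexx.
pose V := fine (mu D).
have V0 : 0 <= V by exact: fine_ge0.
pose K := ((q - 1) * V + 1) / q.
have Istep k : \int[mu]_(x in D) enorm (F k.+1 x - F k x) <= K / (2 ^ k.+1)%:R.
  have Id := (LD k).2.
  have Ic := integrable_cst_fun mD ((q - 1) * r k `^ q) Doo.
  (* Young's inequality with parameter [r k] turns the bound in L^q into one in L^1 *)
  pose c := (q * r k `^ (q - 1))^-1.
  have rq0 : 0 < r k `^ (q - 1) by rewrite powR_gt0.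
  have c0 : 0 < q * r k `^ (q - 1) by rewrite mulr_gt0.
  apply: (@le_trans _ _ (\int[mu]_(x in D)
      (c * ((q - 1) * r k `^ q + enorm (F k.+1 x - F k x) `^ q)))).
    apply: le_Rintegral => //.
    - exact: (integrable_enorm mD Doo q1 (LD k)).
    - apply: (integrable_EFinZ mD); exact: (integrable_EFinD mD).
    move=> x Dx; rewrite mulrC ler_pdivlMr// mulrC.
    by apply: young_powR => //; [exact: ltW|exact: enorm_ge0].
  rewrite RintegralZl//; last exact: (integrable_EFinD mD Ic Id).
  rewrite RintegralD// Rintegral_cst// -/V.
  rewrite mulrC ler_pdivrMr//.
  have le1 : \int[mu]_(x in D) enorm (F k.+1 x - F k x) `^ q <= r k `^ q.
    apply: le_trans (step k); rewrite wenergyE; apply: le_Rintegral => //.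
      exact: integrable_wdensity (LD k).
    move=> x Dx; have /andP[w1 _] := wW Dx.
    by rewrite ler_peMl// powR_ge0.
  have -> : K / (2 ^ k.+1)%:R = K * r k by rewrite /r mul1r.
  have -> : K * r k * (q * r k `^ (q - 1)) = ((q - 1) * V + 1) * (r k * r k `^ (q - 1)).
    by rewrite /K; field; rewrite gt_eqF.
  rewrite mulr_powRB1 ?(ltW (r0 k))//.
  move: (r k `^ q) (\int[mu]_(x in D) _) le1 => a b; lra.
have [G [g [mG Ig Gcvg gdom]]] := fast_cauchy_limit mD (fun k => (LF k).1)
  (integrable_enorm mD Doo q1 (LF 0%N)) (fun k => integrable_enorm mD Doo q1 (LD k)) Istep.
have rcvg : (fun k => m + r k) @ \oo --> m.
  rewrite -[X in _ --> X]addr0; apply: cvgD; first exact: cvg_cst.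
  rewrite (_ : r = geometric 2^-1 2^-1).
    by apply: cvg_geometric; rewrite ger0_norm// invf_lt1// ltr1n.
  apply/funext => k; rewrite /r /geometric/= exprVn expnS natrM natrX invfM mul1r.
  by [].
have [|||||||IwG EG] := @fatou_Rintegral _ _ _ mu D mD
  (fun k x => w x * enorm (F k x) `^ q) (fun x => w x * enorm (G x) `^ q)
  (fun k => m + r k) m.
- by move=> k; exact: integrable_wdensity.
- exact: measurable_wdensity.
- move=> k x Dx; have /andP[w1 _] := wW Dx.
  by rewrite mulr_ge0 ?powR_ge0// (le_trans ler01).
- move=> x Dx; have /andP[w1 _] := wW Dx.
  by rewrite mulr_ge0 ?powR_ge0// (le_trans ler01).
- apply: filterS Gcvg => x + Dx => /(_ Dx) Gx.
  apply: cvgM; first exact: cvg_cst.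
  apply: cvg_powR; [|by move=> n; exact: enorm_ge0|exact: cvg_enorm].
  by rewrite q0/= orbC eq_sym -le_eqVlt enorm_ge0.
- move=> k; rewrite -wenergyE; apply: le_trans (ltW (FP k).2) _; rewrite lerD2l.
  by rewrite ge_min lexx orbT.
- exact: rcvg.
have LG : Lq G.
  split=> //; apply: (ae_dominated_integrable mD _ _ IwG).
    exact: measurable_fun_enorm_powR.
  apply: nearW => x Dx; have /andP[w1 _] := wW Dx.
  by rewrite ger0_norm ?powR_ge0// ler_peMl// powR_ge0.
exists G; first exact: (Acl F G g AF LG Ig Gcvg gdom).
by move=> H AH; apply: le_trans (m_le _ AH); rewrite wenergyE.
Qed.

End weighted_energy.

(** * Borel sets and boxes of the Euclidean space *)
Section rV_topology.
Context {R : realType} {N : nat}.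
Implicit Types (x y : 'rV[R]_N) (A : set 'rV[R]_N).

Lemma measurable_rV_pi (B : 'I_N -> set R) : (forall i, measurable (B i)) ->
  measurable [set x : 'rV[R]_N | forall i, B i (x ord0 i)].
Proof.
move=> mB.
have -> : [set x : 'rV[R]_N | forall i, B i (x ord0 i)] =
    \bigcap_(i in [set` index_enum 'I_N]) (rV_coord i @^-1` B i).
  by apply/seteqP; split=> x Bx i *; apply: Bx => /=; rewrite mem_index_enum.
rewrite bigcap_seq; apply: bigsetI_measurable => i _.
by rewrite -[X in measurable X]setTI; exact: measurable_rV_coord.
Qed.

(** An open set is the union of the boxes with rational centre and radius that it
    contains. *)
Lemma open_measurable_rV A : open A -> measurable A.
Proof.
move=> oA.
pose box (k : 'rV[rat]_N * rat) := [set y : 'rV[R]_N | forall i,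
  `](ratr (k.1 ord0 i) - ratr k.2), (ratr (k.1 ord0 i) + ratr k.2)[%classic (y ord0 i)].
pose F k := if `[< box k `<=` A >] then box k else set0.
suff -> : A = \bigcup_k F k.
  apply: countable_bigcupT_measurable => [|k]; first exact: countableP.
  rewrite /F; case: asboolP => // _.
  apply: (@measurable_rV_pi (fun i =>
    `](ratr (k.1 ord0 i) - ratr k.2), (ratr (k.1 ord0 i) + ratr k.2)[%classic)) => i.
  exact: measurable_itv.
apply/seteqP; split=> [x Ax|x [k _]]; last by rewrite /F; case: asboolP => // H /H.
have /nbhs_ballP[e /= e0 eA] : nbhs x A by exact: open_nbhs_nbhs.
have [|r] := @rat_in_itvoo R 0 (e / 2); first by rewrite divr_gt0.
rewrite in_itv/= => /andP[r0 re].
have /choice[c cP] : forall i, exists c : rat, x ord0 i - ratr r < ratr c < x ord0 i + ratr r.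
  move=> i; have [|c] := @rat_in_itvoo R (x ord0 i - ratr r) (x ord0 i + ratr r).
    by lra.
  by rewrite in_itv/=; exists c.
pose k : 'rV[rat]_N * rat := (\row_i c i, r).
have kA : box k `<=` A.
  move=> y /= yk; apply: eA; split=> // i j; rewrite ord1 /ball/=.
  have := yk j; rewrite /= mxE in_itv/= => /andP[y1 y2].
  have /andP[c1 c2] := cP j.
  by rewrite ltr_norml; apply/andP; split; lra.
exists k => //; rewrite /F; case: asboolP => // _ i; rewrite /= mxE in_itv/=.
by have /andP[c1 c2] := cP i; apply/andP; split; lra.
Qed.

Lemma continuous_measurable_rV (g : 'rV[R]_N -> R) : continuous g ->
  measurable_fun [set: 'rV[R]_N] g.
Proof.
move=> /continuousP cg; apply: (measurability _ (RGenOpens.measurableE R)).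
move=> _ [_ [a [b ->] <-]]; rewrite setTI; apply: open_measurable_rV.
exact/cg/interval_open.
Qed.

Lemma rV_norm_coord x i : `|x ord0 i| <= `|x|.
Proof.
rewrite [leRHS]/Num.norm /= mx_normrE; apply/bigmax_geP; right => /=.
by exists (ord0, i).
Qed.

Lemma rV_norm_le x (M : R) : 0 <= M -> (forall i, `|x ord0 i| <= M) -> `|x| <= M.
Proof.
move=> M0 xM; rewrite [leLHS]/Num.norm /= mx_normrE; apply/bigmax_leP.
by split=> // -[i j] _ /=; rewrite ord1.
Qed.

Definition cube (M : R) : set 'rV[R]_N :=
  [set x | forall i, `[- M, M]%classic (x ord0 i)].

Lemma cubeE (M : R) x : 0 <= M -> cube M x <-> `|x| <= M.
Proof.
move=> M0; split=> [xM|xM i].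
  by apply: rV_norm_le => // i; have := xM i; rewrite /= in_itv/= ler_norml.
by rewrite /= in_itv/= -ler_norml (le_trans (rV_norm_coord _ _)).
Qed.

Lemma measurable_cube M : measurable (cube M).
Proof.
by apply: (@measurable_rV_pi (fun=> `[- M, M]%classic)) => i; exact: measurable_itv.
Qed.

Lemma lebesgue_rV_cube M : (lebesgue_rV N (cube M) < +oo)%E.
Proof.
rewrite (@lebesgue_rV_box R N (fun=> `[- M, M]%classic))//.
rewrite -ge0_fin_numE; last by apply: prode_ge0 => i _.
apply: prode_fin_num => i _; rewrite ge0_fin_numE//.
by rewrite lebesgue_measure_itv/=; case: ifPn => // _; rewrite -EFinB ltry.
Qed.

Lemma bounded_subset_cube A : bounded_set A -> exists2 M : R, 0 <= M & A `<=` cube M.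
Proof.
move=> [M [_ AM]]; exists (`|M| + 1); first by rewrite addr_ge0.
move=> x Ax; apply/cubeE; first by rewrite addr_ge0.
by apply: (AM (`|M| + 1)) => //; rewrite ltr_pwDr// ler_norm.
Qed.

Lemma bounded_lebesgue_rV A : measurable A -> bounded_set A ->
  (lebesgue_rV N A < +oo)%E.
Proof.
move=> mA /bounded_subset_cube[M M0 AM]; apply: le_lt_trans (lebesgue_rV_cube M).
by apply: le_measure => //; rewrite inE//; exact: measurable_cube.
Qed.

End rV_topology.

(** * Translation invariance of the Lebesgue measure *)
Section translation.
Context {R : realType}.

Lemma measurable_shiftR (a : R) : measurable_fun [set: R] (fun x : R => x + a).
Proof. exact: measurable_funD. Qed.

Lemma lebesgue_measure_shift (a : R) (A : set R) : measurable A ->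
  lebesgue_measure ((fun x : R => x + a) @^-1` A) = lebesgue_measure A.
Proof.
move=> mA.
pose sh (x : measurableTypeR R) : measurableTypeR R := (x : R) + a.
have msh : measurable_fun [set: measurableTypeR R] sh by exact: measurable_shiftR.
pose nuM := [the {measure set (measurableTypeR R) -> \bar R} of
  measure_function_pushforward__canonical__measure_function_Measure
     (@lebesgue_measure R) msh].
apply/esym; rewrite -[RHS]/(nuM A); apply: lebesgue_measure_unique => // X.
move=> /ocitvP[->|[[b c] bc ->]]; first by rewrite !measure0.
rewrite /nuM/= /pushforward.
have -> : sh @^-1` `]b, c]%classic = `](b - a), (c - a)]%classic.
  by apply/seteqP; split=> x; rewrite /sh/= !in_itv/= ltrBlDr lerBrDr.
rewrite !lebesgue_measure_itv/= !lte_fin ltrD2r; case: ifPn => // _.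
by rewrite -!EFinB; congr EFin; ring.
Qed.

Lemma measurable_shift_rV n (v : 'rV[R]_n) :
  measurable_fun [set: 'rV[R]_n] (fun x : 'rV[R]_n => x + v).
Proof.
apply/measurable_fun_rVP => i.
rewrite (_ : _ \o _ = fun x : 'rV[R]_n => x ord0 i + v ord0 i).
  by apply: measurable_funD => //; exact: (@measurable_rV_coord _ R n i).
by apply/funext => x; rewrite /rV_coord/= mxE.
Qed.

(** By induction on the dimension: a translation of the product acts on both
    factors, so the translated measure agrees with the product measure on
    rectangles, and a product measure is determined by its values there. *)
Lemma lebesgue_rV_shift n (v : 'rV[R]_n) A : measurable A ->
  lebesgue_rV n ((fun x : 'rV[R]_n => x + v) @^-1` A) = lebesgue_rV n A.
Proof.
elim: n v A => [|n IHn] v A mA.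
  rewrite (_ : (fun x => _) = id)//.
  by apply/funext => x; apply/rowP => -[].
pose h := v ord0 ord0; pose v' := @rsubmx R 1 1 n v.
pose sh (z : R * 'rV[R]_n) : R * 'rV[R]_n := (z.1 + h, z.2 + v').
have msh0 : measurable_fun [set: R * 'rV[R]_n] sh.
  apply/measurable_fun_pairP; split.
    by apply: (measurableT_comp (measurable_shiftR h)).
  by apply: (measurableT_comp (measurable_shift_rV v')).
pose T1 := [the measurableType _ of (measurableTypeR R * 'rV[R]_n)%type].
have msh : measurable_fun [set: T1] (sh : T1 -> T1) by exact: msh0.
have shE z : rV_cons z + v = rV_cons (sh z).
  apply/rowP => i; rewrite mxE; case: (@split_ordP 1 n i) => j ->.
    have consl y : rV_cons y ord0 (lshift n j) = y.1 :> R.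
      exact: etrans (row_mxEl _ _ _ _) (mxE _ _ _ _).
    rewrite !consl /sh/= /h; congr (_ + v _ _); apply/val_inj => /=.
    by rewrite ord1.
  have consr y : rV_cons y ord0 (rshift 1 j) = y.2 ord0 j :> R by exact: row_mxEr.
  by rewrite !consr /sh/= [in RHS]mxE; congr (_ + _); rewrite [RHS]mxE.
rewrite /= /lebesgue_rV_step /pushforward.
have -> : @rV_cons R n @^-1` ((fun x => x + v) @^-1` A) =
    sh @^-1` (@rV_cons R n @^-1` A).
  by apply/seteqP; split=> z /=; rewrite shE.
have mB : measurable (@rV_cons R n @^-1` A).
  by rewrite -[X in measurable X]setTI; exact: measurable_rV_cons.
move: (_ @^-1` A) mB => B mB.
pose nuM := [the {measure set T1 -> \bar R} of
  measure_function_pushforward__canonical__measure_function_Measure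
     (lebesgue_measure \x lebesgue_rV n)%E msh].
apply/esym; rewrite -[RHS]/(nuM B); apply: product_measure_unique => // X Y mX mY.
rewrite /nuM/= /pushforward.
rewrite (_ : sh @^-1` _ = ((fun x => x + h) @^-1` X) `*` ((fun x => x + v') @^-1` Y))//.
rewrite product_measure1E.
- by congr (_ * _)%E; [exact: lebesgue_measure_shift|exact: IHn].
- by rewrite -[X in measurable X]setTI; exact: measurable_shiftR.
- by rewrite -[X in measurable X]setTI; exact: measurable_shift_rV.
Qed.

End translation.

(** * Integrals of partial derivatives *)
Section compact_support.
Context {R : realType} {N : nat}.
Local Notation mu := (@lebesgue_rV R N).
Implicit Types (g : 'rV[R]_N -> R) (x : 'rV[R]_N) (M : R).

Lemma compact_cube M : compact (@cube R N M).
Proof.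
apply: (@rV_compact R N (fun=> `[- M, M]%classic)) => i; exact: segment_compact.
Qed.

Lemma continuous_cube_bounded g M : 0 <= M -> continuous g ->
  (forall x, M < `|x| -> g x = 0) -> exists2 K, 0 <= K & forall x, `|g x| <= K.
Proof.
move=> M0 cg g0.
have : compact (g @` cube M).
  by apply: continuous_compact; [exact: continuous_subspaceT|exact: compact_cube].
move=> /compact_bounded[K [_ gK]].
exists (`|K| + 1); first by rewrite addr_ge0.
move=> x; have [xM|Mx] := leP `|x| M; last by rewrite g0// normr0 addr_ge0.
apply: (gK (`|K| + 1)); first by rewrite ltr_pwDr// ler_norm.
by exists x => //; apply/cubeE.
Qed.

Lemma continuous_cube_integrable g M : 0 <= M -> continuous g ->
  (forall x, M < `|x| -> g x = 0) -> mu.-integrable [set: 'rV[R]_N] (EFin \o g).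
Proof.
move=> M0 cg g0.
have [K K0 gK] := continuous_cube_bounded M0 cg g0.
have mg := continuous_measurable_rV cg.
have -> : EFin \o g = (EFin \o g) \_ (cube M).
  apply/funext => x; rewrite patchE; case: ifPn => // xM /=.
  rewrite g0// ltNge; apply/negP => /cubeE-/(_ M0) xM'.
  by move/negP : xM; apply; rewrite inE.
apply/(integrable_mkcond _ (measurable_cube M)).
apply: (ae_dominated_integrable (measurable_cube M) (g := fun=> K)).
- exact: measurable_funTS.
- exact: nearW.
- apply: integrable_cst_fun; [exact: measurable_cube|exact: lebesgue_rV_cube].
Qed.

Lemma Rintegral_cube g M : 0 <= M -> (forall x, M < `|x| -> g x = 0) ->
  \int[mu]_x g x = \int[mu]_(x in cube M) g x.
Proof.
move=> M0 g0; rewrite [RHS]Rintegral_mkcond; congr (Rintegral _ _ _).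
apply/funext => x; rewrite patchE; case: ifPn => // xM.
rewrite g0// ltNge; apply/negP => /cubeE-/(_ M0) xM'.
by move/negP : xM; apply; rewrite inE.
Qed.

Lemma Rintegral_shift (v : 'rV[R]_N) g : measurable_fun [set: 'rV[R]_N] g ->
  mu.-integrable [set: 'rV[R]_N] (EFin \o (fun x => g (x + v))) ->
  \int[mu]_x g (x + v) = \int[mu]_x g x.
Proof.
move=> mg Ig; rewrite /Rintegral; congr fine.
have := @integral_pushforward _ _ _ _ _ _ (measurable_shift_rV v) mu setT (EFin \o g).
rewrite preimage_setT => <- //; last exact/measurable_EFinP.
apply: eq_measure_integral => [|mphi A mA _]; first exact: measurable_shift_rV.
by rewrite -[RHS](lebesgue_rV_shift v).
Qed.

(** The difference quotients of g in the direction i have integral 0 by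
    translation invariance.  They are bounded, by the mean value theorem and the
    boundedness of the continuous function [partial i g], and supported in a
    fixed cube, so that dominated convergence applies. *)
Lemma Rintegral_partial_eq0 g (i : 'I_N) M : 0 <= M -> continuous g ->
  (forall x, derivable g x (delta_mx ord0 i)) -> continuous (partial i g) ->
  (forall x, M < `|x| -> g x = 0) -> \int[mu]_x partial i g x = 0.
Proof.
move=> M0 cg dg cpg g0; set e : 'rV[R]_N := delta_mx ord0 i in dg *.
have M1_0 : 0 <= M + 1 by rewrite addr_ge0.
have e1 : `|e| <= 1.
  apply: rV_norm_le => // j; rewrite mxE eqxx/=; case: (j == i); by rewrite ?normr1 ?normr0.
have pg0 x : M < `|x| -> partial i g x = 0.
  move=> Mx; rewrite /partial (@near_eq_derive _ _ _ g (cst 0)) ?derive_cst//.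
  have := @norm_continuous _ _ x; move=> /cvgr_gt/(_ _ Mx).
  by apply: filterS => y; exact: g0.
have [K K0 pgK] := continuous_cube_bounded M0 cpg pg0.
have lip x (h : R) : 0 < h -> `|g (x + h *: e) - g x| <= K * h.
  move=> h0; pose phi (t : R) := g (x + t *: e).
  have phiE t : (fun k : R => k^-1 *: ((phi \o shift t) (k *: 1) - phi t)) =
      (fun k : R => k^-1 *: ((g \o shift (x + t *: e)) (k *: e) - g (x + t *: e))).
    apply/funext => k; rewrite /phi/=; congr (_ *: (g _ - _)).
    by rewrite scalerDl addrCA /GRing.scale/= mulr1.
  have dphi t : derivable phi t 1 by rewrite /derivable phiE; exact: dg.
  have [| |c _ cE] := @MVT_segment _ phi (fun t => partial i g (x + t *: e)) 0 h (ltW h0).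
  - by move=> t _; apply: DeriveDef; [exact: dphi|rewrite /derive phiE].
  - by apply: derivable_within_continuous => t _; exact: dphi.
  move: cE; rewrite /phi scale0r addr0 subr0 => ->.
  by rewrite normrM (gtr0_norm h0) ler_pM2r.
pose h (n : nat) : R := n.+1%:R^-1.
have h0 n : 0 < h n by rewrite invr_gt0.
have h1 n : h n <= 1 by rewrite invf_le1// ler1n.
pose q n x := (h n)^-1 * (g (x + h n *: e) - g x).
have mC := @measurable_cube R N (M + 1).
have gs0 n x : M + 1 < `|x| -> g (x + h n *: e) = 0.
  move=> Mx; apply: g0; have := ler_normD (x + h n *: e) (- (h n *: e)).
  rewrite addrK normrN normrZ (gtr0_norm (h0 n)) => xle.
  have : h n * `|e| <= 1 by rewrite mulr_ile1// ltW.
  move: (`|x|) (`|x + _|) (_ * _) Mx xle => a b k; lra.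
have cgs n : continuous (fun x => g (x + h n *: e)).
  move=> x; apply: (@continuous_comp _ _ _ (fun x => x + h n *: e) g); last exact: cg.
  apply: (@continuousD _ _ _ id (cst (h n *: e))); first exact: cvg_id.
  exact: cst_continuous.
have g0' x : M + 1 < `|x| -> g x = 0 by move=> Mx; apply: g0; lra.
have Ig := continuous_cube_integrable M0 cg g0.
have Igs n := continuous_cube_integrable M1_0 (cgs n) (gs0 n).
have IT A f : measurable A -> mu.-integrable setT (EFin \o f) -> mu.-integrable A (EFin \o f).
  by move=> mA If; apply: integrableS If.
have q0 n : \int[mu]_(x in cube (M + 1)) q n x = 0.
  rewrite RintegralZl//; last by apply: integrable_EFinB => //; exact: IT.
  rewrite RintegralB//; [|exact: IT|exact: IT].
  rewrite -(Rintegral_cube M1_0 g0') -(Rintegral_cube M1_0 (gs0 n)).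
  by rewrite (Rintegral_shift (continuous_measurable_rV cg) (Igs n)) subrr mulr0.
rewrite (@Rintegral_cube _ (M + 1))//; last by move=> x Mx; apply: pg0; lra.
have : (fun n => \int[mu]_(x in cube (M + 1)) q n x) @ \oo -->
    \int[mu]_(x in cube (M + 1)) partial i g x.
  apply: (dominated_Rintegral mC (g := fun=> K)).
  - move=> n; apply: measurable_funM => //; apply: measurable_funB.
      by apply: measurable_funTS; exact: continuous_measurable_rV.
    by apply: measurable_funTS; exact: continuous_measurable_rV.
  - by apply: measurable_funTS; exact: continuous_measurable_rV.
  - apply: nearW => x _.
    have hcvg : h @ \oo --> 0^'.
      move=> A; rewrite /dnbhs /within/= => A0.
      have H : \forall n \near \oo, h n != 0 -> A (h n) by exact: (@cvg_harmonic R _ A0).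
      by apply: filterS H => n; apply; exact: lt0r_neq0.
    have := cvg_comp _ _ hcvg (dg x : _ --> partial i g x).
    apply: cvg_trans; apply: near_eq_cvg; apply: nearW => n /=.
    by rewrite /q /= (addrC x).
  - by apply: integrable_cst_fun => //; exact: lebesgue_rV_cube.
  - apply: nearW => x _ n; rewrite /q normrM gtr0_norm ?invr_gt0//.
    by rewrite mulrC ler_pdivrMr//; exact: lip.
under eq_fun do rewrite q0.
by move=> /cvg_lim <-//; rewrite lim_cst.
Qed.

End compact_support.

(** * Test functions *)
Section test_functions.
Context {R : realType} {N : nat}.
Variable Omega : set 'rV[R]_N.
Local Notation mu := (@lebesgue_rV R N).
Local Notation test := (test_function Omega).
Implicit Types (phi psi : 'rV[R]_N -> R) (x : 'rV[R]_N).

Lemma test_differentiable phi x : test phi -> differentiable phi x.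
Proof. by move=> [sm _ _]; exact: (sm [::]). Qed.

Lemma test_continuous phi : test phi -> continuous phi.
Proof. by move=> tphi x; apply: differentiable_continuous; exact: test_differentiable. Qed.

Lemma test_derivable phi x v : test phi -> derivable phi x v.
Proof. by move=> tphi; apply: diff_derivable; exact: test_differentiable. Qed.

Lemma test_partial_continuous phi i : test phi -> continuous (partial i phi).
Proof. by move=> [sm _ _] x; apply: differentiable_continuous; exact: (sm [:: i]). Qed.

Lemma test_out phi x : test phi -> ~ Omega x -> phi x = 0.
Proof.
move=> [_ _ sO] Ox; apply: contrapT => /eqP phix; apply: Ox; apply: sO.
by apply: subset_closure.
Qed.

Lemma partial_out_supp phi i x : ~ closure [set y | phi y != 0] x -> partial i phi x = 0.
Proof.
move=> nx; rewrite /partial (@near_eq_derive _ _ _ phi (cst 0)) ?derive_cst//.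
have oc : open (~` closure [set y | phi y != 0]).
  by apply: closed_openC; exact: closed_closure.
have : nbhs x (~` closure [set y | phi y != 0]) by exact: open_nbhs_nbhs.
apply: filterS => y ny; apply: contrapT => /eqP phiy; apply: ny.
by apply: subset_closure.
Qed.


Lemma test_cube phi : test phi -> exists2 M : R, 0 <= M &
  forall x, M < `|x| -> phi x = 0 /\ forall i, partial i phi x = 0.
Proof.
move=> [_ /compact_bounded/bounded_subset_cube[M M0 sM] _]; exists M => // x Mx.
have nx : ~ closure [set y | phi y != 0] x.
  by move=> /sM /cubeE-/(_ M0); rewrite leNgt Mx.
split=> [|i]; last exact: partial_out_supp.
apply: contrapT => /eqP phix; apply: nx; exact: subset_closure.
Qed.

Lemma test_partial_bounded phi : test phi ->
  exists2 K : R, 0 <= K & forall x i, `|partial i phi x| <= K.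
Proof.
move=> tphi; have [M M0 phiM] := test_cube tphi.
have /choice[K KP] : forall i, exists K, 0 <= K /\ forall x, `|partial i phi x| <= K.
  move=> i; have [|K K0 KP] := continuous_cube_bounded M0 (@test_partial_continuous _ i tphi).
    by move=> x /phiM[_]; exact.
  by exists K.
exists (\sum_i K i); first by apply: sumr_ge0 => i _; exact: (KP i).1.
move=> x i; apply: le_trans ((KP i).2 x) _.
by rewrite (bigD1 i)//= lerDl; apply: sumr_ge0 => j _; exact: (KP j).1.
Qed.

Lemma test_grad_bounded phi : test phi ->
  exists2 K : R, 0 <= K & forall x, enorm (grad phi x) <= K.
Proof.
move=> tphi; have [K K0 KP] := test_partial_bounded tphi.
exists (\sum_(i < N) K); first by apply: sumr_ge0.
move=> x; apply: le_trans (enorm_sum_coord _) _.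
by apply: ler_sum => i _; rewrite mxE.
Qed.

Lemma test_bounded phi : test phi -> exists2 K : R, 0 <= K & forall x, `|phi x| <= K.
Proof.
move=> tphi; have [M M0 phiM] := test_cube tphi.
by apply: (continuous_cube_bounded M0 (test_continuous tphi)) => x /phiM[].
Qed.

Lemma foldr_partial_lin (a : R) phi psi s : smooth phi -> smooth psi ->
  foldr partial (fun x => a * phi x + psi x) s =
  (fun x => a * foldr partial phi s x + foldr partial psi s x).
Proof.
move=> sphi spsi; elim: s => //= i s ->.
apply/funext => x; rewrite /partial.
have d1 : derivable (foldr partial phi s) x (delta_mx ord0 i).
  by apply: diff_derivable; exact: sphi.
have d2 : derivable (foldr partial psi s) x (delta_mx ord0 i).
  by apply: diff_derivable; exact: spsi.
rewrite (_ : (fun x => _) = a *: foldr partial phi s + foldr partial psi s)//.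
rewrite deriveD; [|by apply: derivableZ; exact: d1|exact: d2].
by rewrite deriveZ; [|exact: d1].
Qed.

Lemma test_lin (a : R) phi psi : test phi -> test psi ->
  test (fun x => a * phi x + psi x).
Proof.
move=> [s1 c1 o1] [s2 c2 o2].
have sub : closure [set x | a * phi x + psi x != 0] `<=`
    closure [set x | phi x != 0] `|` closure [set x | psi x != 0].
  rewrite -closureU; apply: closure_subset => x /= n0.
  have [phi0|] := eqVneq (phi x) 0; last by left.
  by right; rewrite phi0 mulr0 add0r in n0.
split.
- move=> s x; rewrite foldr_partial_lin//.
  apply: (@differentiableD _ _ _ (a *: foldr partial phi s) (foldr partial psi s)).
    by apply: differentiableZ; exact: s1.
  exact: s2.
- apply: (@subclosed_compact _ _ (closure [set x | phi x != 0] `|` closure [set x | psi x != 0])) => //.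
    exact: closed_closure.
  exact: compactU.
- by move=> x /sub[/o1|/o2].
Qed.

Lemma grad_lin (a : R) phi psi x : test phi -> test psi ->
  grad (fun x => a * phi x + psi x) x = a *: grad phi x + grad psi x.
Proof.
move=> [s1 _ _] [s2 _ _]; apply/rowP => i; rewrite !mxE.
by have := foldr_partial_lin a [:: i] s1 s2; rewrite /= => ->.
Qed.

Lemma measurable_grad phi : test phi -> measurable_fun [set: 'rV[R]_N] (grad phi).
Proof.
move=> tphi; apply/measurable_fun_rVP => i.
rewrite (_ : _ \o _ = partial i phi).
  by apply: continuous_measurable_rV; exact: test_partial_continuous.
by apply/funext => x; rewrite /rV_coord/= mxE.
Qed.

Lemma Rintegral_out (h : 'rV[R]_N -> R) : (forall x, ~ Omega x -> h x = 0) ->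
  \int[mu]_(x in Omega) h x = \int[mu]_x h x.
Proof.
move=> h0; rewrite [LHS]Rintegral_mkcond; congr (Rintegral _ _ _).
apply/funext => x; rewrite patchE; case: ifPn => // xO.
by rewrite h0// => Ox; move/negP : xO; apply; rewrite inE.
Qed.

(** Leibniz' rule for the product phi psi, whose partial derivative has integral
    0. *)
Lemma test_by_parts phi psi i : test phi -> test psi ->
  \int[mu]_(x in Omega) (phi x * partial i psi x) =
  - \int[mu]_(x in Omega) (partial i phi x * psi x).
Proof.
move=> t1 t2.
have [M M0 phiM] := test_cube t1.
have c1 := test_continuous t1; have c2 := test_continuous t2.
have p1 := @test_partial_continuous _ i t1; have p2 := @test_partial_continuous _ i t2.
have prodE : partial i (fun x => phi x * psi x) =
    fun x => phi x * partial i psi x + partial i phi x * psi x.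
  apply/funext => x; rewrite /partial (_ : (fun x => _) = phi * psi)//.
  rewrite deriveM; [|exact: test_derivable|exact: test_derivable].
  by congr (_ + _); rewrite /GRing.scale/= mulrC.
have ca : continuous (fun x => phi x * partial i psi x).
  by move=> x; apply: continuousM; [exact: c1|exact: p2].
have cb : continuous (fun x => partial i phi x * psi x).
  by move=> x; apply: continuousM; [exact: p1|exact: c2].
have za x : M < `|x| -> phi x * partial i psi x = 0.
  by move=> /phiM[-> _]; rewrite mul0r.
have zb x : M < `|x| -> partial i phi x * psi x = 0.
  by move=> /phiM[_ ->]; rewrite mul0r.
have Ia := continuous_cube_integrable M0 ca za.
have Ib := continuous_cube_integrable M0 cb zb.
rewrite !Rintegral_out; first last.
- by move=> x Ox; rewrite (test_out t1)// mul0r.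
- by move=> x Ox; rewrite (test_out t2)// mulr0.
apply/eqP; rewrite -addr_eq0 -RintegralD//; apply/eqP.
rewrite -[RHS](@Rintegral_partial_eq0 R N (fun x => phi x * psi x) i M M0).
- by rewrite prodE.
- by move=> x; apply: continuousM; [exact: c1|exact: c2].
- by move=> x; apply: derivableM; exact: test_derivable.
- by rewrite prodE => x; exact: (continuousD (ca x) (cb x)).
- by move=> x /phiM[-> _]; rewrite mul0r.
Qed.

End test_functions.

(** * Sobolev functions and fields with prescribed divergence *)
Section sobolev.
Context {R : realType} {N : nat}.
Variable Omega : set 'rV[R]_N.
Hypothesis oO : open Omega.
Hypothesis bO : bounded_set Omega.
Local Notation mu := (@lebesgue_rV R N).
Local Notation test := (test_function Omega).
Implicit Types (u phi : 'rV[R]_N -> R) (G F : 'rV[R]_N -> 'rV[R]_N) (p q : R).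

Let mO : measurable Omega := open_measurable_rV oO.
Let Ooo : (mu Omega < +oo)%E := bounded_lebesgue_rV mO bO.

Lemma Lp_norm_powR u p : 0 < p ->
  (Lp_norm Omega p u `^ p = \int[mu]_(x in Omega) (`|u x| `^ p)%:E)%E.
Proof.
move=> p0; rewrite /Lp_norm powR_Lnorm ?gt_eqF// [RHS]integral_mkcond.
apply: eq_integral => x _; rewrite !patchE; case: ifPn => // _.
by rewrite abse0 poweR0r// gt_eqF.
Qed.

Lemma measurable_norm_powR u p : measurable_fun Omega u ->
  measurable_fun Omega (fun x => `|u x| `^ p).
Proof.
move=> mu_; apply: (@measurableT_comp _ _ _ _ _ _ (@powR R ^~ p)).
  exact: measurable_powR.
exact: measurableT_comp.
Qed.

(** The norm is the p-th root of an extended real integral; its finiteness is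
    thus the integrability of the p-th power. *)
Lemma Lp_norm_ltyP u p : 0 < p -> measurable_fun Omega u ->
  (Lp_norm Omega p u < +oo)%E <->
  mu.-integrable Omega (EFin \o (fun x => `|u x| `^ p)).
Proof.
move=> p0 mu_; split=> [uoo|/(EFin_Rintegral mO) uoo].
  apply: ge0_integrable => //; first exact: measurable_norm_powR.
  by rewrite -(Lp_norm_powR u p0); exact: poweR_lty.
rewrite ltey; apply/eqP => Loo.
have := Lp_norm_powR u p0; rewrite Loo poweRyr ?gt_eqF// uoo.
by [].
Qed.

Lemma Lp_norm_lt_Rintegral u p (e : R) : 0 < p -> measurable_fun Omega u ->
  (Lp_norm Omega p u < e%:E)%E -> \int[mu]_(x in Omega) (`|u x| `^ p) <= e `^ p.
Proof.
move=> p0 mu_ ue.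
have Iu : mu.-integrable Omega (EFin \o (fun x => `|u x| `^ p)).
  by apply/Lp_norm_ltyP => //; apply: lt_trans ue _; rewrite ltry.
rewrite -lee_fin -EFin_Rintegral// -Lp_norm_powR//.
have N0 : (0 <= Lp_norm Omega p u)%E by exact: Lnorm_ge0.
move: (Lp_norm Omega p u) N0 ue => [r| |]//=; rewrite !lee_fin lte_fin => r0 re.
by apply: ge0_ler_powR; rewrite ?nnegrE ?(ltW p0)// ltW// (le_lt_trans r0).
Qed.

Lemma in_LpVP F p : 0 < p -> in_LpV Omega p F <-> Lq_field mu Omega p F.
Proof.
move=> p0; have E : (fun x => `|(enorm \o F) x| `^ p) = (fun x => enorm (F x) `^ p).
  by apply/funext => x; rewrite ger0_norm// enorm_ge0.
split=> -[mF h]; split=> //.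
  by move/Lp_norm_ltyP : h; rewrite E; apply=> //; exact: measurable_fun_enorm.
by apply/Lp_norm_ltyP; rewrite ?E//; exact: measurable_fun_enorm.
Qed.

Lemma in_Lp_integrable u p : 1 < p -> in_Lp Omega p u ->
  mu.-integrable Omega (EFin \o u).
Proof.
move=> p1 [mu_ /Lp_norm_ltyP Iu]; have p0 : 0 < p := lt_trans ltr01 p1.
have {}Iu := Iu p0 mu_.
apply: (@ae_dominated_integrable _ _ _ _ _ mO _ (fun x => (p - 1) * 1 + `|u x| `^ p)) => //.
- apply: nearW => x Dx; have := young_powR p1 ler01 (normr_ge0 (u x)).
  rewrite !powR1 !mulr1; apply: le_trans.
  by rewrite ler_peMl// ltW.
- by apply: integrable_EFinD => //; exact: (integrable_cst_fun mO ((p - 1) * 1) Ooo).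
Qed.

Lemma integrable_bounded_mul (h k : 'rV[R]_N -> R) (K : R) :
  mu.-integrable Omega (EFin \o h) -> measurable_fun Omega k ->
  (forall x, `|k x| <= K) -> mu.-integrable Omega (EFin \o (fun x => h x * k x)).
Proof.
move=> Ih mk kK.
have In : mu.-integrable Omega (EFin \o (fun x => K * `|h x|)).
  by apply: integrable_EFinZ => //; exact: integrable_norm.
apply: (ae_dominated_integrable mO _ _ In).
  by apply: measurable_funM => //; exact: integrable_measurable Ih.
by apply: nearW => x _; rewrite normrM mulrC ler_wpM2r.
Qed.

Lemma bounded_Omega_integrable (k : 'rV[R]_N -> R) (K : R) : measurable_fun Omega k ->
  (forall x, `|k x| <= K) -> mu.-integrable Omega (EFin \o k).
Proof.
move=> mk kK; apply: (ae_dominated_integrable mO mk _ (integrable_cst_fun mO K Ooo)).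
exact: nearW.
Qed.

Lemma test_measurable phi : test phi -> measurable_fun Omega phi.
Proof.
by move=> t; apply: measurable_funTS; apply: continuous_measurable_rV; exact: test_continuous t.
Qed.

Lemma test_partial_measurable phi i : test phi -> measurable_fun Omega (partial i phi).
Proof.
by move=> t; apply: measurable_funTS; apply: continuous_measurable_rV; exact: test_partial_continuous t.
Qed.

Lemma test_in_Lp phi p : 1 < p -> test phi -> in_Lp Omega p phi.
Proof.
move=> p1 t; have p0 : 0 < p := lt_trans ltr01 p1.
split; first exact: test_measurable.
apply/Lp_norm_ltyP => //; first exact: test_measurable.
have [K K0 phiK] := test_bounded t.
apply: (@bounded_Omega_integrable _ (K `^ p)).
  by apply: measurable_norm_powR; exact: test_measurable.
move=> x; rewrite ger0_norm ?powR_ge0//.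
by apply: ge0_ler_powR; rewrite ?nnegrE// ltW.
Qed.

Lemma measurable_grad_Omega phi : test phi -> measurable_fun Omega (grad phi).
Proof. by move=> t; apply: measurable_funTS; exact: measurable_grad t. Qed.

Lemma test_grad_Lq phi p : 1 < p -> test phi -> Lq_field mu Omega p (grad phi).
Proof.
move=> p1 t; have p0 : 0 < p := lt_trans ltr01 p1.
have mg := measurable_grad_Omega t.
split=> //; have [K K0 gK] := test_grad_bounded t.
apply: (@bounded_Omega_integrable _ (K `^ p)); first exact: measurable_fun_enorm_powR.
move=> x; rewrite ger0_norm ?powR_ge0//.
by apply: ge0_ler_powR; rewrite ?nnegrE ?enorm_ge0// ltW.
Qed.

Lemma weak_gradientP u G : mu.-integrable Omega (EFin \o u) ->
  (forall i, mu.-integrable Omega (EFin \o (fun x => G x ord0 i))) ->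
  weak_gradient Omega u G <-> forall phi i, test phi ->
    \int[mu]_(x in Omega) (u x * partial i phi x) =
    - \int[mu]_(x in Omega) (G x ord0 i * phi x).
Proof.
move=> Iu IG.
have I1 phi i : test phi -> mu.-integrable Omega (EFin \o (fun x => u x * partial i phi x)).
  move=> t; have [K K0 pK] := test_partial_bounded t.
  by apply: (@integrable_bounded_mul _ _ K) => //; exact: test_partial_measurable.
have I2 phi i : test phi -> mu.-integrable Omega (EFin \o (fun x => G x ord0 i * phi x)).
  move=> t; have [K K0 pK] := test_bounded t.
  by apply: (@integrable_bounded_mul _ _ K) => //; exact: test_measurable.
split=> H phi i t.
  have := H phi i t; rewrite (EFin_Rintegral mO (I1 _ _ t)) (EFin_Rintegral mO (I2 _ _ t)).
  by rewrite -EFinN => -[].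
rewrite (EFin_Rintegral mO (I1 _ _ t)) (EFin_Rintegral mO (I2 _ _ t)).
by rewrite -EFinN H.
Qed.

Lemma Lq_coord_integrable F p i : 1 < p -> Lq_field mu Omega p F ->
  mu.-integrable Omega (EFin \o (fun x => F x ord0 i)).
Proof.
move=> p1 LF; apply: (ae_dominated_integrable mO _ _ (integrable_enorm mO Ooo p1 LF)).
  exact: (measurable_rV_within mO F).1 LF.1 i.
by apply: nearW => x _; exact: enorm_coord.
Qed.

Lemma W1p_add_test (a : R) u G phi p : 1 < p -> W1p Omega p u G -> test phi ->
  W1p Omega p (fun x => a * phi x + u x) (fun x => a *: grad phi x + G x).
Proof.
move=> p1 [Lu LG wG] t; have p0 : 0 < p := lt_trans ltr01 p1.
have {}LG : Lq_field mu Omega p G by apply/in_LpVP.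
have Lg := test_grad_Lq p1 t.
have LaG : Lq_field mu Omega p (fun x => a *: grad phi x + G x).
  exact: (Lq_fieldD mO (ltW p0) (Lq_fieldZ mO a Lg) LG).
have Iphi := in_Lp_integrable p1 (test_in_Lp p1 t).
have Iu := in_Lp_integrable p1 Lu.
have Iau := integrable_EFinD mO (integrable_EFinZ mO a Iphi) Iu.
have mau : measurable_fun Omega (fun x => a * phi x + u x).
  exact: integrable_measurable Iau.
split.
- split=> //; apply/Lp_norm_ltyP => //.
  have [_ /Lp_norm_ltyP I1] := test_in_Lp p1 t.
  have [mu_ /Lp_norm_ltyP I2] := Lu.
  have {}I1 := I1 p0 (test_measurable t); have {}I2 := I2 p0 mu_.
  apply: (ae_dominated_integrable mO (g := fun x =>
    2 `^ p * (`|a| `^ p * `|phi x| `^ p + `|u x| `^ p))).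
  + exact: measurable_norm_powR.
  + apply: nearW => x _; rewrite ger0_norm ?powR_ge0// -powRM//.
    apply: le_trans (powR_add_le (ltW p0) _ _); rewrite ?mulr_ge0//.
    apply: ge0_ler_powR; rewrite ?nnegrE ?addr_ge0 ?mulr_ge0 ?(ltW p0)//.
    by rewrite -normrM ler_normD.
  + by apply: integrable_EFinZ => //; apply: integrable_EFinD => //; exact: integrable_EFinZ.
- exact/in_LpVP.
apply/weak_gradientP => //; first by move=> i; exact: Lq_coord_integrable p1 LaG.
move=> psi i tpsi.
have [Kp Kp0 pK] := test_partial_bounded tpsi; have [K K0 psiK] := test_bounded tpsi.
have mpp := @test_partial_measurable _ i tpsi; have mpsi := test_measurable tpsi.
have J1 := integrable_bounded_mul Iphi mpp (pK ^~ i).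
have J2 := integrable_bounded_mul Iu mpp (pK ^~ i).
have J3 := integrable_bounded_mul (Lq_coord_integrable i p1 Lg) mpsi psiK.
have J4 := integrable_bounded_mul (Lq_coord_integrable i p1 LG) mpsi psiK.
have wG' := (weak_gradientP Iu (fun i => Lq_coord_integrable i p1 LG)).1 wG psi i tpsi.
have J1' := integrable_EFinZ mO a J1; have J3' := integrable_EFinZ mO a J3.
transitivity (\int[mu]_(x in Omega) (a * (phi x * partial i psi x) + u x * partial i psi x)).
  by apply: eq_Rintegral => x _; ring.
rewrite (RintegralD mO J1' J2) (RintegralZl _ mO J1) wG' (test_by_parts i t tpsi).
transitivity (- \int[mu]_(x in Omega) (a * (grad phi x ord0 i * psi x) + G x ord0 i * psi x)).
  rewrite (RintegralD mO J3' J4) (RintegralZl _ mO J3) opprD mulrN; congr (- (a * _) - _).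
  by apply: eq_Rintegral => x _; rewrite mxE.
by congr (- _); apply: eq_Rintegral => x _; rewrite !mxE; ring.
Qed.

Lemma Lp_norm0 p : 0 < p -> Lp_norm Omega p (fun=> 0) = 0%E.
Proof.
move=> p0; rewrite /Lp_norm (_ : _ \_ _ = cst 0%E) ?Lnorm0//.
  by rewrite eqe gt_eqF.
by apply/funext => x; rewrite patchE; case: ifP.
Qed.

Lemma W1p_test phi p : 1 < p -> test phi -> W1p Omega p phi (grad phi).
Proof.
move=> p1 t; have p0 : 0 < p := lt_trans ltr01 p1.
split; first exact: test_in_Lp.
  by apply/in_LpVP => //; exact: test_grad_Lq.
apply/weak_gradientP.
- exact: in_Lp_integrable (test_in_Lp p1 t).
- by move=> i; exact: Lq_coord_integrable (test_grad_Lq p1 t).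
move=> psi i tpsi; rewrite (test_by_parts i t tpsi); congr (- _).
by apply: eq_Rintegral => x _; rewrite mxE.
Qed.

Lemma W1p0_test phi p : 1 < p -> test phi -> W1p0 Omega p phi (grad phi).
Proof.
move=> p1 t; have p0 : 0 < p := lt_trans ltr01 p1.
split; first exact: W1p_test.
move=> e e0; exists phi => //; rewrite /W1p_norm.
rewrite (_ : (phi \- phi) = fun=> 0); last by apply/funext => x; rewrite /= subrr.
rewrite (_ : enorm \o _ = fun=> 0); last by apply/funext => x; rewrite /= subrr enorm0.
by rewrite Lp_norm0// add0e lte_fin.
Qed.

(** The approximations of u are moved by the same test function, so the error does
    not change. *)
Lemma W1p0_add_test (a : R) u G phi p : 1 < p -> W1p0 Omega p u G -> test phi ->
  W1p0 Omega p (fun x => a * phi x + u x) (fun x => a *: grad phi x + G x).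
Proof.
move=> p1 [WG apx] t; split; first exact: W1p_add_test.
move=> e /apx[psi tpsi lte].
exists (fun x => a * phi x + psi x).
  exact: (test_lin a t tpsi).
rewrite (_ : (_ \- _)%R = u \- psi); last by apply/funext => x /=; ring.
rewrite (_ : (fun x => _) = (fun x => G x - grad psi x)%R)//.
apply/funext => x; rewrite (grad_lin _ _ t tpsi).
by rewrite opprD addrACA subrr add0r.
Qed.

Lemma W1p0_grad_approx u G p (e : R) : 1 < p -> W1p0 Omega p u G -> 0 < e ->
  exists2 phi, test phi &
    \int[mu]_(x in Omega) (enorm (G x - grad phi x) `^ p) <= e.
Proof.
move=> p1 [[_ LG _] apx] e0; have p0 : 0 < p := lt_trans ltr01 p1.
have [phi tphi lte] := apx (e `^ p^-1) (powR_gt0 _ e0).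
exists phi => //.
have mB : measurable_fun Omega (fun x => G x - grad phi x).
  by apply: measurable_fun_rVB => //; [exact: LG.1|exact: measurable_grad_Omega].
have lte2 : (Lp_norm Omega p (enorm \o (fun x => G x - grad phi x)%R) < (e `^ p^-1)%:E)%E.
  by apply: le_lt_trans lte; rewrite /W1p_norm leeDr//; exact: Lnorm_ge0.
have eE : (e `^ p^-1) `^ p = e.
  by rewrite -powRrM mulVf ?powRr1 ?(ltW e0)//; exact: lt0r_neq0 p0.
have := Lp_norm_lt_Rintegral p0 (measurable_fun_enorm mO mB) lte2.
rewrite eE; apply: le_trans.
rewrite le_eqVlt; apply/orP; left; apply/eqP; apply: eq_Rintegral => x _.
by rewrite /= ger0_norm// enorm_ge0.
Qed.

(** The integral of G . F equals that of (G - grad phi) . F for every test function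
    phi.  By Young's inequality with a small weight on F, it is as small as
    wanted once grad phi is close to G in L^p. *)
Lemma W1p0_orthogonal u G p q F : 1 < p -> q = p / (p - 1) -> W1p0 Omega p u G ->
  Lq_field mu Omega q F ->
  (forall phi, test phi -> \int[mu]_(x in Omega) dotv (grad phi x) (F x) = 0) ->
  \int[mu]_(x in Omega) dotv (G x) (F x) = 0.
Proof.
move=> p1 qE WG LF F0; have p0 : 0 < p := lt_trans ltr01 p1.
have p10 : 0 < p - 1 by rewrite subr_gt0.
have q0 : 0 < q by rewrite qE divr_gt0.
have LG : Lq_field mu Omega p G by apply/in_LpVP => //; case: WG => -[].
pose J := \int[mu]_(x in Omega) (enorm (F x) `^ q).
have J0 : 0 <= J by apply: Rintegral_ge0 => x _; exact: powR_ge0.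
apply/eqP; rewrite -normr_le0; apply/ler_addgt0Pr => e e0; rewrite add0r.
(* a weight for which the share of F in Young's inequality is at most e / 2 *)
pose d := (e / 2 / (J + 1)) `^ q^-1.
have d0 : 0 < d by rewrite powR_gt0// divr_gt0 ?divr_gt0// ltr_wpDl.
have dq : d `^ q * J <= e / 2.
  rewrite -powRrM mulVf ?gt_eqF// powRr1; last first.
    by rewrite divr_ge0 ?divr_ge0 ?addr_ge0 ?(ltW e0).
  by rewrite mulrAC ler_pdivrMr ?ltr_wpDl// ler_pM2l ?divr_gt0// lerDl.
have e'0 : 0 < d `^ p * (e / 2) by apply: mulr_gt0; [exact: powR_gt0|exact: divr_gt0].
have [phi tphi apx] := W1p0_grad_approx p1 WG e'0.
have Lg := test_grad_Lq p1 tphi.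
have LB := Lq_fieldB mO (ltW p0) LG Lg.
have IB := integrable_dotv mO p1 qE LB LF.
have Ig := integrable_dotv mO p1 qE Lg LF.
have -> : \int[mu]_(x in Omega) dotv (G x) (F x) =
    \int[mu]_(x in Omega) dotv (G x - grad phi x) (F x).
  rewrite -[RHS]addr0 -(F0 _ tphi) -RintegralD//.
  by apply: eq_Rintegral => x _; rewrite -dotvDl subrK.
apply: le_trans (le_normr_Rintegral mO IB) _.
have I1 := integrable_EFinZ mO (d^-1 `^ p) LB.2.
have I2 := integrable_EFinZ mO (d `^ q) LF.2.
apply: (@le_trans _ _ (\int[mu]_(x in Omega)
   (d^-1 `^ p * enorm (G x - grad phi x) `^ p + d `^ q * enorm (F x) `^ q))).
  apply: le_Rintegral => //; [exact: integrable_norm|exact: integrable_EFinD|].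
  move=> x _; apply: le_trans (dotv_abs _ _) _.
  rewrite -!powRM ?enorm_ge0 ?invr_ge0 ?(ltW d0)//.
  set A := enorm _; set B := enorm _.
  have A0 : 0 <= A by exact: enorm_ge0.
  have B0 : 0 <= B by exact: enorm_ge0.
  have -> : A * B = (d^-1 * A) * (d * B) by field; rewrite gt_eqF.
  apply: le_trans (@conjugate_powR _ _ _ p q _ _ p0 q0 _) _.
  - by rewrite mulr_ge0// invr_ge0 ltW.
  - by rewrite mulr_ge0// ltW.
  - by rewrite qE; field; rewrite !gt_eqF.
  apply: lerD; rewrite ler_pdivrMr// ler_peMr ?powR_ge0// ltW//.
  by rewrite qE ltr_pdivlMr// mul1r ltrBlDr ltrDl.
have h1 : d^-1 `^ p * \int[mu]_(x in Omega) (enorm (G x - grad phi x) `^ p) <= e / 2.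
  apply: (@le_trans _ _ (d^-1 `^ p * (d `^ p * (e / 2)))).
    by rewrite ler_pM2l ?powR_gt0 ?invr_gt0.
  by rewrite mulrA -powRM ?invr_ge0 ?(ltW d0)// mulVf ?gt_eqF// powR1 mul1r.
rewrite (RintegralD mO I1 I2) (RintegralZl _ mO LB.2) (RintegralZl _ mO LF.2) -/J.
by have := lerD h1 dq; rewrite -splitr.
Qed.

Lemma integrable_dotv_grad F phi q : 1 < q -> Lq_field mu Omega q F -> test phi ->
  mu.-integrable Omega (EFin \o (fun x => dotv (F x) (grad phi x))).
Proof.
move=> q1 LF t; have [K K0 gK] := test_grad_bounded t.
apply: (ae_dominated_integrable mO _ _
  (integrable_EFinZ mO K (integrable_enorm mO Ooo q1 LF))).
  by apply: measurable_fun_dotv => //; [exact: LF.1|exact: measurable_grad_Omega].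
apply: nearW => x _; apply: le_trans (dotv_abs _ _) _.
by rewrite mulrC ler_wpM2r// enorm_ge0.
Qed.

Lemma minus_divP F (f : ('rV[R]_N -> R) -> R) q : 1 < q -> Lq_field mu Omega q F ->
  minus_div Omega F f <-> forall phi, test phi ->
    \int[mu]_(x in Omega) dotv (F x) (grad phi x) = f phi.
Proof.
move=> q1 LF; split=> H phi t.
  by have := H phi t; rewrite (EFin_Rintegral mO (integrable_dotv_grad q1 LF t)) => -[].
by rewrite (EFin_Rintegral mO (integrable_dotv_grad q1 LF t)) H.
Qed.

End sobolev.

(** * Saddle points *)
Section saddle_point.
Context {R : realType} {X Y : Type}.
Variables (A : set X) (B : set Y) (J : X -> Y -> \bar R) (x0 : X) (y0 : Y).
Hypotheses (Ax0 : A x0) (By0 : B y0).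
Hypothesis max0 : forall y, B y -> (J x0 y <= J x0 y0)%E.
Hypothesis min0 : forall x, A x -> (J x0 y0 <= J x y0)%E.
Hypothesis exmax : forall x, A x -> exists y, is_max B (J x) y.
Hypothesis exmin : forall y, B y -> exists x, is_min A (J ^~ y) x.

Lemma saddle_minmax : solves_minmax A B J x0 (J x0 y0).
Proof.
have /choice[M MP] : forall x, exists m, A x -> exists2 y, is_max B (J x) y & J x y = m.
  move=> x; have [Ax|nAx] := pselect (A x); last by exists 0%E.
  by have [y ymax] := exmax Ax; exists (J x y) => _; exists y.
have M0 : M x0 = J x0 y0.
  have [y [By ymax] <-] := MP _ Ax0.
  by apply/eqP; rewrite eq_le max0// ymax.
exists M; split=> //; split=> // x Ax; rewrite M0; apply: le_trans (min0 Ax) _.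
by have [y [_ ymax] <-] := MP _ Ax; exact: ymax.
Qed.

Lemma saddle_maxmin : solves_maxmin A B J y0 (J x0 y0).
Proof.
have /choice[m mP] : forall y, exists m, B y -> exists2 x, is_min A (J ^~ y) x & J x y = m.
  move=> y; have [By|nBy] := pselect (B y); last by exists 0%E.
  by have [x xmin] := exmin By; exists (J x y) => _; exists x.
have m0 : m y0 = J x0 y0.
  have [x [Ax xmin] <-] := mP _ By0.
  by apply/eqP; rewrite eq_le min0// xmin.
exists m; split=> //; split=> // y By; rewrite m0; apply: le_trans _ (max0 By).
by have [x [_ xmin] <-] := mP _ By; exact: xmin.
Qed.

(** Any solution x of the min-max problem minimises J(., y0) as well: J(x, y0) is
    at most the inner maximum at x, hence at most the one at x0. *)
Lemma saddle_minmax_le x v : solves_minmax A B J x v ->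
  A x /\ (J x y0 <= J x0 y0)%E.
Proof.
move=> [M [MP [Ax Mmin] _]]; split=> //.
have [y [_ ymax] yE] := MP _ Ax; have [z [Bz _] zE] := MP _ Ax0.
apply: le_trans (ymax _ By0) _; rewrite yE; apply: le_trans (Mmin _ Ax0) _.
by rewrite -zE max0.
Qed.

End saddle_point.

(** * The duality map between gradients and fluxes *)
Section flux.
Context {R : realType} {N : nat}.
Implicit Types (x y : 'rV[R]_N) (p q w : R).

Lemma enorm_powR_dotv_le x y p : 1 < p ->
  enorm x `^ (p - 2) * `|dotv x y| <= enorm x `^ (p - 1) * enorm y.
Proof.
move=> p1; have [->|x0] := eqVneq x 0.
  by rewrite dot0v normr0 mulr0 mulr_ge0 ?powR_ge0 ?enorm_ge0.
have X0 : 0 < enorm x by rewrite lt_def enorm_eq0 x0 enorm_ge0.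
rewrite (_ : p - 1 = (p - 2) + 1); last by ring.
rewrite (gt0_powRD (p - 2) 1 X0) powRr1 ?enorm_ge0// -mulrA ler_wpM2l ?powR_ge0//.
exact: dotv_abs.
Qed.

(** The vector field |x|^(p-2) x is continuous, also at the origin, where its norm
    |x|^(p-1) tends to 0. *)
Lemma cvg_powR_dotv (F : nat -> 'rV[R]_N) x y p : 1 < p ->
  (forall i, (fun n => F n ord0 i) @ \oo --> x ord0 i) ->
  (fun n => enorm (F n) `^ (p - 2) * dotv (F n) y) @ \oo -->
    enorm x `^ (p - 2) * dotv x y.
Proof.
move=> p1 Fx.
have cn := cvg_enorm Fx.
have [x_0|x0] := eqVneq x 0; last first.
  have X0 : 0 < enorm x by rewrite lt_def enorm_eq0 x0 enorm_ge0.
  apply: cvgM; last by apply: cvg_dotv => // i; exact: cvg_cst.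
  by apply: cvg_powR cn; rewrite ?X0// => n; exact: enorm_ge0.
rewrite {2}x_0 dot0v mulr0; apply/norm_cvg0P.
have lim0 : (fun n => enorm (F n) `^ (p - 1) * enorm y) @ \oo --> (0 : R).
  rewrite -[X in _ --> X](mul0r (enorm y)); apply: cvgM; last exact: cvg_cst.
  rewrite -[X in _ --> X](@powR0 _ (p - 1)); last by rewrite subr_eq0 gt_eqF.
  apply: cvg_powR; first by rewrite subr_gt0 p1 eqxx orbT.
    by move=> n; exact: enorm_ge0.
  by have := cn; rewrite x_0 enorm0.
apply: (squeeze_cvgr _ (cvg_cst 0) lim0); apply: nearW => n /=.
by rewrite normr_ge0 normrM ger0_norm ?powR_ge0// enorm_powR_dotv_le.
Qed.

Lemma powR_inv w r : 0 < w -> w^-1 `^ r = (w `^ r)^-1.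
Proof. by move=> w0; rewrite -(powR_inv1 (ltW w0)) -powRrM mulN1r powRN. Qed.

Lemma enorm_flux x p w : 1 < p -> 0 < w ->
  enorm ((enorm x `^ (p - 2) / w `^ (p - 1)) *: x) = (enorm x / w) `^ (p - 1).
Proof.
move=> p1 w0; rewrite enormZ ger0_norm ?divr_ge0 ?powR_ge0//.
have [->|x0] := eqVneq x 0.
  by rewrite enorm0 mulr0 mul0r powR0// subr_eq0 gt_eqF.
have X0 : 0 < enorm x by rewrite lt_def enorm_eq0 x0 enorm_ge0.
rewrite powRM ?invr_ge0 ?(ltW w0) ?enorm_ge0//.
rewrite powR_inv// mulrAC; congr (_ / _).
rewrite -[X in _ * X]powRr1 ?enorm_ge0// -gt0_powRD//; congr (_ `^ _); ring.
Qed.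

Lemma enorm_flux_powR x p q w : 1 < p -> q = p / (p - 1) -> 0 < w ->
  enorm ((enorm x `^ (p - 2) / w `^ (p - 1)) *: x) `^ q = (enorm x / w) `^ p.
Proof.
move=> p1 qE w0; rewrite enorm_flux// -powRrM; congr (_ `^ _).
by rewrite qE; field; rewrite subr_eq0 gt_eqF.
Qed.

(** The duality map of exponent q inverts the one of exponent p, because
    (p - 1)(q - 1) = 1. *)
Lemma flux_inverse x p q w : 1 < p -> q = p / (p - 1) -> 0 < w ->
  let s := (enorm x `^ (p - 2) / w `^ (p - 1)) *: x in
  (w * enorm s `^ (q - 2)) *: s = x.
Proof.
move=> p1 qE w0 s; have p10 : 0 < p - 1 by rewrite subr_gt0.
have [x_0|x0] := eqVneq x 0; first by rewrite /s x_0 !scaler0.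
have X0 : 0 < enorm x by rewrite lt_def enorm_eq0 x0 enorm_ge0.
rewrite /s enorm_flux// scalerA -[RHS]scale1r; congr (_ *: _).
have xw0 : 0 < enorm x / w by rewrite divr_gt0.
rewrite -powRrM.
have -> : (p - 1) * (q - 2) = - (p - 2) by rewrite qE; field; rewrite gt_eqF.
rewrite powRN powRM ?invr_ge0 ?(ltW w0) ?enorm_ge0//.
rewrite powR_inv//.
have -> : w `^ (p - 1) = w * w `^ (p - 2).
  rewrite -[X in X * _]powRr1 ?(ltW w0)// -gt0_powRD//; congr (_ `^ _); ring.
by field; rewrite !gt_eqF ?powR_gt0.
Qed.

End flux.

(** * First order conditions for the relaxed problem *)
Section relaxed_problem.
Context {R : realType} {N : nat}.
Variables (Omega : set 'rV[R]_N) (p q c kappa : R) (f : ('rV[R]_N -> R) -> R).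
Hypotheses (oO : open Omega) (bO : bounded_set Omega).
Hypotheses (p1 : 1 < p) (qE : q = p / (p - 1)) (c0 : 0 < c).
Hypotheses (f_dual : dual_W1p0 Omega p f).
Local Notation mu := (@lebesgue_rV R N).
Local Notation test := (test_function Omega).
Local Notation Lq := (Lq_field mu Omega).
Implicit Types (b eta : 'rV[R]_N -> R) (G H F tau : 'rV[R]_N -> 'rV[R]_N).

Let mO : measurable Omega := open_measurable_rV oO.
Let Ooo : (mu Omega < +oo)%E := bounded_lebesgue_rV mO bO.
Let p0 : 0 < p := lt_trans ltr01 p1.
Let p10 : 0 < p - 1. Proof. by rewrite subr_gt0. Qed.
Let q1 : 1 < q.
Proof. by rewrite qE ltr_pdivlMr// mul1r ltrBlDr ltrDl. Qed.
Let q0 : 0 < q := lt_trans ltr01 q1.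

(** Densities take their values in [0, 1] only almost everywhere.  Clipping
    replaces them by representatives for which the weights are bounded
    everywhere. *)
Definition clip b (x : 'rV[R]_N) : R := Num.max 0 (Num.min 1 (b x)).

Lemma clip01 b x : 0 <= clip b x <= 1.
Proof. by rewrite /clip le_max lexx/= ge_max ler01 ge_min lexx. Qed.

Lemma clip_id b x : 0 <= b x <= 1 -> clip b x = b x.
Proof. by move=> /andP[b0 b1]; rewrite /clip min_r// max_r. Qed.

Lemma measurable_clip b : measurable_fun Omega b -> measurable_fun Omega (clip b).
Proof.
move=> mb; apply: measurable_maxr => //; exact: measurable_minr.
Qed.

Definition weight b (x : 'rV[R]_N) : R := 1 + c * clip b x.

Lemma weight_bounds b x : 1 <= weight b x <= 1 + c.
Proof.
have /andP[b0 b1] := clip01 b x.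
rewrite /weight lerDl mulr_ge0 ?(ltW c0)//= lerD2l.
by rewrite ger_pMr.
Qed.

Lemma weight_gt0 b x : 0 < weight b x.
Proof. by have /andP[w1 _] := weight_bounds b x; exact: lt_le_trans w1. Qed.

Lemma measurable_weight b : measurable_fun Omega b -> measurable_fun Omega (weight b).
Proof.
move=> mb; apply: measurable_funD => //.
by apply: measurable_funM => //; exact: measurable_clip.
Qed.

Lemma integrable_density b : measurable_fun Omega b ->
  {ae mu, forall x, Omega x -> 0 <= b x <= 1} -> mu.-integrable Omega (EFin \o b).
Proof.
move=> mb b01; apply: (ae_dominated_integrable mO mb _ (integrable_cst_fun mO 1 Ooo)).
by apply: filterS b01 => x + Ox => /(_ Ox)/andP[b0 b1]; rewrite ger0_norm.
Qed.

Lemma ThetaP b : Theta Omega kappa b <-> [/\ measurable_fun Omega b,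
    {ae mu, forall x, Omega x -> 0 <= b x <= 1} &
    \int[mu]_(x in Omega) b x <= kappa].
Proof.
split=> -[mb b01 le]; split=> //; have Ib := integrable_density mb b01.
  by rewrite -lee_fin -EFin_Rintegral.
by rewrite EFin_Rintegral// lee_fin.
Qed.

Lemma clip_ae b : Theta Omega kappa b ->
  {ae mu, forall x, Omega x -> clip b x = b x}.
Proof.
by move=> [_ + _]; apply: filterS => x + Ox => /(_ Ox) b01; rewrite clip_id.
Qed.

Lemma Theta_clip b : Theta Omega kappa b -> Theta Omega kappa (clip b).
Proof.
move=> tb; have /ThetaP[mb b01 le] := tb; apply/ThetaP.
have mc := measurable_clip mb.
split=> //; first by apply: nearW => x _; exact: clip01.
apply: le_trans le; rewrite le_eqVlt; apply/orP; left; apply/eqP.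
by apply: (ae_eq_Rintegral mO) => //; exact: clip_ae.
Qed.

Lemma Theta_convex b eta (t : R) : 0 <= t <= 1 -> Theta Omega kappa b ->
  Theta Omega kappa eta ->
  Theta Omega kappa (fun x => clip b x + t * (clip eta x - clip b x)).
Proof.
move=> /andP[t0 t1] /Theta_clip tb /Theta_clip te.
have /ThetaP[mb b01 lb] := tb; have /ThetaP[me e01 le] := te.
have Ib := integrable_density mb b01; have Ie := integrable_density me e01.
have Id := integrable_EFinB mO Ie Ib.
apply/ThetaP; split.
- apply: measurable_funD => //; apply: measurable_funM => //; exact: measurable_funB.
- apply: nearW => x _; have := clip01 b x; have := clip01 eta x.
  by move: (clip b x) (clip eta x) => u v /andP[v0 v1] /andP[u0 u1]; apply/andP; split; nra.
rewrite (RintegralD mO Ib (integrable_EFinZ mO t Id)) (RintegralZl _ mO Id) (RintegralB mO Ie Ib).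
move: (\int[mu]_(x in Omega) clip b x) (\int[mu]_(x in Omega) clip eta x) lb le => u v; nra.
Qed.

Lemma dual_energyE tau b : Theta Omega kappa b -> Lq q tau ->
  dual_energy Omega c q tau b = (weighted_energy mu Omega q (weight b) tau)%:E.
Proof.
move=> tb Lt; have /ThetaP[mb b01 lb] := tb.
have mt := measurable_fun_enorm_powR mO q Lt.1.
have Iw := integrable_wdensity mO (measurable_weight mb) (fun x _ => weight_bounds b x) Lt.
rewrite wenergyE -EFin_Rintegral// /dual_energy; apply: ae_eq_integral => //.
- apply/measurable_EFinP; apply: measurable_funM => //.
  by apply: measurable_funD => //; apply: measurable_funM.
- exact: measurable_int Iw.
by apply: filterS (clip_ae tb) => x + Ox => /(_ Ox) E; rewrite /weight E.
Qed.

Definition renergy H b : R :=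
  \int[mu]_(x in Omega) (enorm (H x) `^ p / weight b x `^ (p - 1)).

Lemma integrable_weight_powR H b (r : R) : 0 <= r -> measurable_fun Omega b -> Lq p H ->
  mu.-integrable Omega (EFin \o (fun x => enorm (H x) `^ p / weight b x `^ r)).
Proof.
move=> r0 mb LH; apply: (ae_dominated_integrable mO _ _ LH.2).
  apply: measurable_funM; first by apply: measurable_fun_enorm_powR => //; exact: LH.1.
  rewrite (_ : (fun x => _) = (fun x => weight b x `^ (- r))).
    apply: (@measurableT_comp _ _ _ _ _ _ (@powR R ^~ (- r))).
      exact: measurable_powR.
    exact: measurable_weight.
  by apply/funext => x; rewrite powRN.
apply: nearW => x _; have /andP[w1 _] := weight_bounds b x.
rewrite ger0_norm ?divr_ge0 ?powR_ge0// ler_pdivrMr ?powR_gt0 ?weight_gt0//.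
rewrite ler_peMr ?powR_ge0//.
by rewrite -(powRr0 (weight b x)) ler_powR.
Qed.

Lemma energyE u H b : Theta Omega kappa b -> Lq p H ->
  energy Omega p c f u H b = (p^-1 * renergy H b - f u)%:E.
Proof.
move=> tb LH; have /ThetaP[mb b01 lb] := tb.
have Iw := integrable_weight_powR (ltW p10) mb LH.
rewrite /energy EFinB EFinM; congr (_ * _ - _)%E.
rewrite /renergy -(EFin_Rintegral mO Iw); apply: ae_eq_integral; first exact: mO.
- apply/measurable_EFinP; apply: measurable_funM.
    by apply: measurable_fun_enorm_powR => //; exact: LH.1.
  rewrite (_ : (fun x => _) = (fun x => (1 + c * b x) `^ (- (p - 1)))); last first.
    by apply/funext => x; rewrite powRN.
  apply: (@measurableT_comp _ _ _ _ _ _ (@powR R ^~ (- (p - 1)))).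
    exact: measurable_powR.
  by apply: measurable_funD => //; apply: measurable_funM.
- exact: measurable_int Iw.
by apply: filterS (clip_ae tb) => x + Ox => /(_ Ox) E; rewrite /weight E.
Qed.

Section optimality.
Variables (u : 'rV[R]_N -> R) (G : 'rV[R]_N -> 'rV[R]_N) (theta : 'rV[R]_N -> R).
Hypothesis sol : solves_R Omega p c kappa f u G theta.

Let WG : W1p0 Omega p u G. Proof. by case: sol. Qed.
Let tth : Theta Omega kappa theta. Proof. by case: sol. Qed.
Let mth : measurable_fun Omega theta. Proof. by case: tth. Qed.
Let LG : Lq p G. Proof. by apply/(in_LpVP oO G p0); case: WG => -[]. Qed.
Let w x := weight theta x.
Let w0 x : 0 < w x := weight_gt0 theta x.
Let mw : measurable_fun Omega w := measurable_weight mth.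

(** The flux computed with the clipped density; it agrees almost everywhere with
    the flux of theta. *)
Definition opt_flux : 'rV[R]_N -> 'rV[R]_N :=
  fun x => (enorm (G x) `^ (p - 2) / weight theta x `^ (p - 1)) *: G x.

Lemma measurable_opt_flux : measurable_fun Omega opt_flux.
Proof.
apply: (measurable_fun_rVZ mO _ LG.1); apply: measurable_funM.
  exact: measurable_fun_enorm_powR LG.1.
rewrite (_ : (fun x => _) = (fun x => w x `^ (- (p - 1)))); last first.
  by apply/funext => x; rewrite powRN.
by apply: (@measurableT_comp _ _ _ _ _ _ (@powR R ^~ (- (p - 1)))) => //; exact: measurable_powR.
Qed.

Lemma opt_flux_powR x : enorm (opt_flux x) `^ q = enorm (G x) `^ p / w x `^ p.
Proof.
rewrite (enorm_flux_powR (G x) p1 qE (w0 x)) powRM ?enorm_ge0 ?invr_ge0 ?(ltW (w0 x))//.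
by rewrite powR_inv.
Qed.

Lemma Lq_opt_flux : Lq q opt_flux.
Proof.
split; first exact: measurable_opt_flux.
rewrite (_ : (fun x => _) = (fun x => enorm (G x) `^ p / weight theta x `^ p)).
  exact: (integrable_weight_powR (ltW p0) mth LG).
by apply/funext => x; rewrite opt_flux_powR.
Qed.

(** Compare the energies at u and at u + t s phi, t > 0.  The tangent inequality of
    |.|^p at the moved gradient bounds the increment by t times the integral of
    the flux at the moved gradient against s grad phi; divide by t and let t go
    to 0.  Both signs of s are needed for the equation. *)
Lemma opt_flux_div_le phi (s : R) : test phi ->
  s * f phi <= s * \int[mu]_(x in Omega) dotv (opt_flux x) (grad phi x).
Proof.
move=> t; pose K x := s *: grad phi x.
have Lg := test_grad_Lq oO bO p1 t.
have LK : Lq p K by exact: Lq_fieldZ.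
pose h (n : nat) : R := n.+1%:R^-1.
have h0 n : 0 < h n by rewrite invr_gt0.
have h1 n : h n <= 1 by rewrite invf_le1// ler1n.
pose X n x := h n *: K x + G x.
have LX n : Lq p (X n) := Lq_fieldD mO (ltW p0) (Lq_fieldZ mO (h n) LK) LG.
pose D n x := enorm (X n x) `^ (p - 2) * dotv (X n x) (K x) / w x `^ (p - 1).
pose D0 x := enorm (G x) `^ (p - 2) * dotv (G x) (K x) / w x `^ (p - 1).
pose dom x := 2 `^ p * (enorm (G x) `^ p + enorm (K x) `^ p) + enorm (K x) `^ p.
have Idom : mu.-integrable Omega (EFin \o dom).
  apply: integrable_EFinD => //; last exact: LK.2.
  by apply: integrable_EFinZ => //; apply: integrable_EFinD => //; [exact: LG.2|exact: LK.2].
have mwp : measurable_fun Omega (fun x => (w x `^ (p - 1))^-1).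
  rewrite (_ : (fun x => _) = (fun x => w x `^ (- (p - 1)))); last first.
    by apply/funext => x; rewrite powRN.
  by apply: (@measurableT_comp _ _ _ _ _ _ (@powR R ^~ (- (p - 1)))) => //; exact: measurable_powR.
have mD Y : measurable_fun Omega Y ->
    measurable_fun Omega (fun x => enorm (Y x) `^ (p - 2) * dotv (Y x) (K x) / w x `^ (p - 1)).
  move=> mY; apply: measurable_funM => //; apply: measurable_funM.
    exact: measurable_fun_enorm_powR.
  by apply: measurable_fun_dotv => //; exact: LK.1.
have wp1 x : (w x `^ (p - 1))^-1 <= 1.
  have /andP[w1 _] := weight_bounds theta x.
  rewrite (invf_le1 (powR_gt0 _ (w0 x))).
  by have := ler_powR w1 (ltW p10); rewrite powRr0.
have wp0 x : 0 < (w x `^ (p - 1))^-1 by rewrite invr_gt0 powR_gt0// w0.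
have Ddom n x : `|D n x| <= dom x.
  rewrite /D normrM (gtr0_norm (wp0 x)) normrM (ger0_norm (powR_ge0 _ _)).
  have A := enorm_powR_dotv_le (X n x) (K x) p1.
  have B := young_powR p1 (enorm_ge0 (X n x)) (enorm_ge0 (K x)).
  have C : enorm (X n x) `^ p <= 2 `^ p * (enorm (G x) `^ p + enorm (K x) `^ p).
    apply: le_trans (powR_add_le (ltW p0) (enorm_ge0 _) (enorm_ge0 _)).
    apply: ge0_ler_powR; rewrite ?nnegrE ?addr_ge0 ?enorm_ge0 ?(ltW p0)//.
    rewrite addrC; apply: le_trans (enormD _ _) _; rewrite lerD2r enormZ (gtr0_norm (h0 n)).
    by rewrite ler_piMl ?enorm_ge0.
  apply: (@le_trans _ _ (enorm (X n x) `^ (p - 2) * `|dotv (X n x) (K x)|)).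
    by rewrite ler_piMr// mulr_ge0// powR_ge0.
  apply: le_trans A _; rewrite /dom.
  have E1 := powR_ge0 (enorm (X n x)) p; have E2 := powR_ge0 (enorm (K x)) p.
  move: (_ * (_ + _)) C B E1 E2 => k; rewrite -mulrA.
  move: (enorm (X n x) `^ p) (enorm (K x) `^ p) (_ `^ (p - 1) * _) => a e m.
  move=> ak pm a0 e0; have := p1; nra.
have ID n : mu.-integrable Omega (EFin \o D n).
  by apply: (ae_dominated_integrable mO (mD _ (LX n).1) _ Idom); apply: nearW => x _; exact: Ddom.
have step n : s * f phi <= \int[mu]_(x in Omega) D n x.
  have WX := W1p0_add_test oO bO (h n * s) p1 WG t.
  have XE : (fun x => (h n * s) *: grad phi x + G x) = X n.
    by apply/funext => x; rewrite /X /K scalerA.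
  rewrite XE in WX.
  have [_ _ /(_ _ _ _ WX tth)] := sol.
  rewrite (energyE _ tth LG) (energyE _ tth (LX n)) lee_fin.
  have [fl _] := f_dual.
  rewrite (fl _ _ _ _ _ (W1p0_test oO bO p1 t) WG).
  have I1 := integrable_weight_powR (ltW p10) mth (LX n).
  have I2 := integrable_weight_powR (ltW p10) mth LG.
  have : renergy (X n) theta - renergy G theta <= (p * h n) * \int[mu]_(x in Omega) D n x.
    rewrite /renergy -(RintegralB mO I1 I2) -(RintegralZl _ mO (ID n)).
    apply: (le_Rintegral mO); [exact: integrable_EFinB|exact: integrable_EFinZ|].
    move=> x _; have T := enorm_powR_tangent (X n x) (G x) p1.
    rewrite (_ : G x - X n x = - (h n *: K x)) in T; last first.
      by rewrite /X opprD addrCA subrr addr0.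
    rewrite dotvNr dotvZr in T.
    rewrite /D -mulrBl mulrA ler_wpM2r ?(ltW (wp0 x))//.
    move: (enorm (X n x) `^ p) (enorm (G x) `^ p) (enorm (X n x) `^ (p - 2)) (dotv (X n x) (K x)) T.
    move=> a b e m; lra.
  move: (renergy (X n) theta) (renergy G theta) (\int[mu]_(x in Omega) D n x) => a b I ab.
  move=> le; rewrite -(ler_pM2l (h0 n)).
  have : p^-1 * (a - b) <= p^-1 * (p * h n * I) by rewrite ler_pM2l ?invr_gt0.
  have -> : p^-1 * (p * h n * I) = h n * I by field; exact: lt0r_neq0.
  move: le; rewrite mulrBr mulrA.
  move: (p^-1 * a) (p^-1 * b) (h n * I) (h n * s * f phi) (f u) => *; lra.
have lim : (fun n => \int[mu]_(x in Omega) D n x) @ \oo --> \int[mu]_(x in Omega) D0 x.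
  apply: (dominated_Rintegral mO _ _ _ Idom).
  - by move=> n; apply: mD; exact: (LX n).1.
  - by apply: mD; exact: LG.1.
  - apply: nearW => x _; apply: cvgM; last exact: cvg_cst.
    apply: cvg_powR_dotv => // i.
    rewrite (_ : (fun n => _) = (fun n => h n * K x ord0 i + G x ord0 i)); last first.
      by apply/funext => n; rewrite /X !mxE.
    rewrite -[X in _ --> X]add0r -(mul0r (K x ord0 i)).
    apply: cvgD; last exact: cvg_cst.
    by apply: cvgM; [exact: cvg_harmonic|exact: cvg_cst].
  - by apply: nearW => x _ n; exact: Ddom.
have Iflux := integrable_dotv_grad oO bO q1 Lq_opt_flux t.
have <- : \int[mu]_(x in Omega) D0 x =
    s * \int[mu]_(x in Omega) dotv (opt_flux x) (grad phi x).
  rewrite -(RintegralZl _ mO Iflux); apply: eq_Rintegral => x _.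
  by rewrite /D0 /opt_flux /K dotvZl dotvZr -/(w x); ring.
by apply: (cvgr_to_ge lim); exact: nearW.
Qed.

Lemma opt_flux_div phi : test phi ->
  \int[mu]_(x in Omega) dotv (opt_flux x) (grad phi x) = f phi.
Proof.
move=> t; have := opt_flux_div_le 1 t; have := opt_flux_div_le (-1) t.
rewrite !mul1r !mulN1r lerN2 => h1 h2.
by apply/eqP; rewrite eq_le h1 h2.
Qed.

(** Compare the energies at theta and at theta + t (eta - theta).  The tangent
    inequality of x^(1-p) at the moved weight W bounds p times the increment by
    -(p - 1) c t times the integral of |G|^p / W^p (eta - theta), which is
    therefore at most 0 for every t > 0; let t go to 0. *)
Lemma opt_flux_density_le eta : Theta Omega kappa eta ->
  \int[mu]_(x in Omega)
    (enorm (opt_flux x) `^ q * (clip eta x - clip theta x)) <= 0.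
Proof.
move=> te; have me : measurable_fun Omega eta by case: te.
pose h (n : nat) : R := n.+1%:R^-1.
have h0 n : 0 < h n by rewrite invr_gt0.
have h1 n : h n <= 1 by rewrite invf_le1// ler1n.
pose df x := clip eta x - clip theta x.
have mdf : measurable_fun Omega df by apply: measurable_funB; exact: measurable_clip.
have df1 x : `|df x| <= 1.
  rewrite /df; have := clip01 eta x; have := clip01 theta x.
  by move: (clip _ _) (clip _ _) => a e /andP[a0 a1] /andP[e0 e1]; rewrite ler_norml; apply/andP; split; lra.
pose b n x := clip theta x + h n * df x.
have tb n : Theta Omega kappa (b n) by apply: Theta_convex => //; rewrite h1 ltW.
have mb n : measurable_fun Omega (b n) by case: (tb n).
have wb n x : weight (b n) x = w x + c * h n * df x.
  rewrite {1}/weight clip_id; first by rewrite /w /weight /b; ring.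
  have := clip01 eta x; have := clip01 theta x; have := h0 n; have := h1 n; rewrite /b /df.
  move: (h n) (clip _ _) (clip _ _) => t a e t1 t0 /andP[a0 a1] /andP[e0 e1].
  by apply/andP; split; nra.
have I1 g : measurable_fun Omega g -> mu.-integrable Omega
    (EFin \o (fun x => enorm (G x) `^ p / weight g x `^ p * df x)).
  move=> mg; have I := integrable_weight_powR (ltW p0) mg LG.
  apply: (ae_dominated_integrable mO _ _ I).
    by apply: measurable_funM => //; exact: integrable_measurable I.
  apply: nearW => x _; rewrite normrM ger0_norm ?divr_ge0 ?powR_ge0//.
  by rewrite ler_piMr ?divr_ge0 ?powR_ge0.
have step n : \int[mu]_(x in Omega) (enorm (G x) `^ p / weight (b n) x `^ p * df x) <= 0.
  have [_ _ /(_ _ _ _ WG (tb n))] := sol.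
  rewrite (energyE _ tth LG) (energyE _ (tb n) LG) lee_fin lerD2r ler_pM2l ?invr_gt0//.
  have J1 := integrable_weight_powR (ltW p10) mth LG.
  have J2 := integrable_weight_powR (ltW p10) (mb n) LG.
  rewrite -subr_ge0 /renergy -(RintegralB mO J2 J1) => le0.
  have k0 : 0 < (p - 1) * (c * h n) by rewrite !mulr_gt0.
  rewrite -oppr_ge0 -(pmulr_rge0 _ k0) mulrN -mulNr -(RintegralZl _ mO (I1 _ (mb n))).
  apply: le_trans le0 _.
  apply: (le_Rintegral mO); [exact: integrable_EFinB|exact: (integrable_EFinZ mO _ (I1 _ (mb n)))|].
  move=> x _; have := powRN_tangent p10 (weight_gt0 (b n) x) (w0 x).
  rewrite (_ : - (p - 1) - 1 = - p); last by ring.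
  rewrite !powRN (_ : w x - weight (b n) x = - (c * h n * df x)); last by rewrite wb; ring.
  rewrite -/(w x) => T; have := ler_wpM2l (powR_ge0 (enorm (G x)) p) T.
  move: (_ `^ (p - 1))^-1 (_ `^ (p - 1))^-1 (_ `^ p)^-1 (enorm (G x) `^ p) (c * h n) => A B C g k.
  lra.
have lim : (fun n => \int[mu]_(x in Omega) (enorm (G x) `^ p / weight (b n) x `^ p * df x)) @ \oo -->
    \int[mu]_(x in Omega) (enorm (G x) `^ p / w x `^ p * df x).
  apply: (dominated_Rintegral mO _ _ _ LG.2).
  - by move=> n; exact: integrable_measurable (I1 _ (mb n)).
  - exact: integrable_measurable (I1 _ mth).
  - apply: nearW => x _; apply: cvgM; last exact: cvg_cst.
    apply: cvgM; first exact: cvg_cst.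
    apply: cvgV; first by apply: lt0r_neq0; rewrite powR_gt0 ?w0.
    apply: cvg_powR; [by rewrite w0|by move=> n; exact/ltW/weight_gt0|].
    have wl : (fun n => w x + c * h n * df x) @ \oo --> w x + c * 0 * df x.
      apply: cvgD; first exact: cvg_cst.
      apply: cvgM; last exact: cvg_cst.
      by apply: cvgM; [exact: cvg_cst|exact: cvg_harmonic].
    rewrite mulr0 mul0r addr0 in wl.
    rewrite (_ : (fun n => _) = (fun n => w x + c * h n * df x))//.
    by apply/funext => n; exact: wb.
  - apply: nearW => x _ n; have /andP[w1 _] := weight_bounds (b n) x.
    have wp1 : 1 <= weight (b n) x `^ p by have := ler_powR w1 (ltW p0); rewrite powRr0.
    rewrite normrM ger0_norm ?divr_ge0 ?powR_ge0//.
    apply: (@le_trans _ _ (enorm (G x) `^ p / weight (b n) x `^ p)).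
      by rewrite ler_piMr ?divr_ge0 ?powR_ge0.
    by rewrite ler_pdivrMr ?(lt_le_trans ltr01)// ler_peMr// powR_ge0.
rewrite (@eq_Rintegral _ _ R mu Omega (fun x => enorm (G x) `^ p / w x `^ p * df x)); last first.
  by move=> x _; rewrite opt_flux_powR.
by apply: (cvgr_to_le lim); exact: nearW.
Qed.

Lemma opt_flux_max eta : Theta Omega kappa eta ->
  weighted_energy mu Omega q (weight eta) opt_flux <=
  weighted_energy mu Omega q (weight theta) opt_flux.
Proof.
move=> te; have me : measurable_fun Omega eta by case: te.
have I1 := integrable_wdensity mO (measurable_weight me) (fun x _ => weight_bounds eta x) Lq_opt_flux.
have I2 := integrable_wdensity mO (measurable_weight mth) (fun x _ => weight_bounds theta x) Lq_opt_flux.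
rewrite !wenergyE -subr_le0 -(RintegralB mO I1 I2).
have I3 : mu.-integrable Omega (EFin \o (fun x => enorm (opt_flux x) `^ q * (clip eta x - clip theta x))).
  have := integrable_EFinZ mO c^-1 (integrable_EFinB mO I1 I2).
  rewrite (_ : (fun x => _) = (fun x => enorm (opt_flux x) `^ q * (clip eta x - clip theta x)))//.
  by apply/funext => x; rewrite /weight; field; exact: lt0r_neq0.
rewrite (@eq_Rintegral _ _ R mu Omega (fun x => c * (enorm (opt_flux x) `^ q * (clip eta x - clip theta x)))).
  by rewrite (RintegralZl _ mO I3) pmulr_rle0// opt_flux_density_le.
by move=> x _; rewrite /weight; ring.
Qed.

(** By [flux_inverse], the tangent inequality of |.|^q at the flux has the gradient
    G of u as its slope. *)
Lemma opt_flux_min tau : Lq q tau ->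
  (forall phi, test phi -> \int[mu]_(x in Omega) dotv (tau x) (grad phi x) = f phi) ->
  weighted_energy mu Omega q (weight theta) opt_flux <=
  weighted_energy mu Omega q (weight theta) tau.
Proof.
move=> Lt tdiv.
have LD := Lq_fieldB mO (ltW q0) Lt Lq_opt_flux.
have orth : \int[mu]_(x in Omega) dotv (G x) (tau x - opt_flux x) = 0.
  apply: (W1p0_orthogonal oO bO p1 qE WG LD) => phi t.
  have I1 := integrable_dotv_grad oO bO q1 Lt t.
  have I2 := integrable_dotv_grad oO bO q1 Lq_opt_flux t.
  rewrite (@eq_Rintegral _ _ R mu Omega (fun x => dotv (tau x) (grad phi x) - dotv (opt_flux x) (grad phi x))).
    by rewrite (RintegralB mO I1 I2) tdiv// opt_flux_div// subrr.
  by move=> x _; rewrite dotvC dotvBl.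
have I1 := integrable_wdensity mO (measurable_weight mth) (fun x _ => weight_bounds theta x) Lq_opt_flux.
have I2 := integrable_wdensity mO (measurable_weight mth) (fun x _ => weight_bounds theta x) Lt.
have I3 := integrable_dotv mO p1 qE LG LD.
rewrite !wenergyE -[X in X <= _]addr0 -(mulr0 q) -orth.
rewrite -(RintegralZl _ mO I3) -(RintegralD mO I1 (integrable_EFinZ mO q I3)).
apply: (le_Rintegral mO _ I2); first exact: (integrable_EFinD mO I1 (integrable_EFinZ mO q I3)).
move=> x _; have T := enorm_powR_tangent (opt_flux x) (tau x) q1.
have := ler_wpM2l (ltW (w0 x)) T.
rewrite -[in X in _ -> _ + q * X <= _](flux_inverse (G x) p1 qE (w0 x)) -/(opt_flux x).
rewrite dotvZl -/(w x).
move: (w x) (enorm _ `^ q) (enorm _ `^ q) (enorm _ `^ (q - 2)) (dotv _ _) => v A B C e; lra.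
Qed.

End optimality.
End relaxed_problem.

(** * Attainment of the inner extrema *)
Section existence.
Context {R : realType} {N : nat}.
Variables (Omega : set 'rV[R]_N) (q c kappa : R) (f : ('rV[R]_N -> R) -> R).
Hypotheses (oO : open Omega) (bO : bounded_set Omega).
Hypotheses (q1 : 1 < q) (c0 : 0 < c).
Local Notation mu := (@lebesgue_rV R N).
Local Notation test := (test_function Omega).
Local Notation Lq := (Lq_field mu Omega).
Local Notation A := (admissible_flux Omega f q).
Local Notation J := (dual_energy Omega c q).
Implicit Types (tau rho : 'rV[R]_N -> 'rV[R]_N) (b : 'rV[R]_N -> R).

Let mO : measurable Omega := open_measurable_rV oO.
Let Ooo : (mu Omega < +oo)%E := bounded_lebesgue_rV mO bO.
Let q0 : 0 < q := lt_trans ltr01 q1.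

Lemma admissible_fluxP tau : A tau <-> Lq q tau /\
  forall phi, test phi -> \int[mu]_(x in Omega) dotv (tau x) (grad phi x) = f phi.
Proof.
split=> [[/(in_LpVP oO tau q0) Lt td]|[Lt td]].
  by split=> //; exact/(minus_divP oO bO f q1 Lt).
by split; [exact/(in_LpVP oO tau q0)|exact/(minus_divP oO bO f q1 Lt)].
Qed.

Lemma Lq_field_ae tau rho : measurable_fun Omega tau ->
  {ae mu, forall x, Omega x -> tau x = rho x} -> Lq q rho -> Lq q tau.
Proof.
move=> mt E Lr; split=> //; apply: (ae_dominated_integrable mO _ _ Lr.2).
  exact: measurable_fun_enorm_powR mt.
by apply: filterS E => x + Ox => /(_ Ox) ->; rewrite ger0_norm ?powR_ge0.
Qed.

Lemma admissible_flux_ae tau rho : measurable_fun Omega tau ->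
  {ae mu, forall x, Omega x -> tau x = rho x} -> A rho -> A tau.
Proof.
move=> mt E /admissible_fluxP[Lr rd]; apply/admissible_fluxP.
have Lt := Lq_field_ae mt E Lr; split=> // phi t; rewrite -rd//.
apply: (ae_eq_Rintegral mO).
- exact: integrable_measurable (integrable_dotv_grad oO bO q1 Lt t).
- exact: integrable_measurable (integrable_dotv_grad oO bO q1 Lr t).
by apply: filterS E => x + Ox => /(_ Ox) ->.
Qed.

Lemma dual_energy_ae tau rho b : Theta Omega kappa b -> measurable_fun Omega tau ->
  {ae mu, forall x, Omega x -> tau x = rho x} -> Lq q rho -> J tau b = J rho b.
Proof.
move=> tb mt E Lr; have Lt := Lq_field_ae mt E Lr.
have mb : measurable_fun Omega b by case: tb.
rewrite (dual_energyE oO bO c0 tb Lt) (dual_energyE oO bO c0 tb Lr).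
congr EFin; rewrite !wenergyE; apply: (ae_eq_Rintegral mO).
- exact: (measurable_wdensity mO q (measurable_weight c mb) Lt.1).
- exact: (measurable_wdensity mO q (measurable_weight c mb) Lr.1).
by apply: filterS E => x + Ox => /(_ Ox) ->.
Qed.

Lemma admissible_flux_mid tau rho : A tau -> A rho ->
  A (fun x => 2^-1 *: (tau x + rho x)).
Proof.
move=> /admissible_fluxP[Lt td] /admissible_fluxP[Lr rd]; apply/admissible_fluxP.
split=> [|phi t]; first exact: (Lq_mid mO q1 Lt Lr).
have I1 := integrable_dotv_grad oO bO q1 Lt t.
have I2 := integrable_dotv_grad oO bO q1 Lr t.
have I3 := integrable_EFinD mO I1 I2.
rewrite (@eq_Rintegral _ _ R mu Omega (fun x =>
  2^-1 * (dotv (tau x) (grad phi x) + dotv (rho x) (grad phi x)))).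
  rewrite (RintegralZl _ mO I3) (RintegralD mO I1 I2) td// rd//; by field.
by move=> x _; rewrite dotvZl dotvDl.
Qed.

Lemma admissible_flux_closed : dominated_ae_closed mu Omega q A.
Proof.
move=> F tau g AF Lt Ig Ft Fg; apply/admissible_fluxP; split=> // phi t.
have LF n : Lq q (F n) by have /admissible_fluxP[] := AF n.
have [K K0 gK] := test_grad_bounded t.
have mg : measurable_fun Omega (grad phi) := measurable_grad_Omega t.
have lim : (fun n => \int[mu]_(x in Omega) dotv (F n x) (grad phi x)) @ \oo -->
    \int[mu]_(x in Omega) dotv (tau x) (grad phi x).
  apply: (dominated_Rintegral mO _ _ _ (integrable_EFinZ mO K Ig)).
  - by move=> n; apply: measurable_fun_dotv => //; exact: (LF n).1.
  - by apply: measurable_fun_dotv => //; exact: Lt.1.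
  - apply: filterS Ft => x + Ox => /(_ Ox) Fx; apply: cvg_dotv => // i.
    exact: cvg_cst.
  - apply: filterS Fg => x + Ox n => /(_ Ox n) Fx.
    apply: le_trans (dotv_abs _ _) _; rewrite mulrC.
    by apply: ler_pM => //; exact: enorm_ge0.
have E : (fun n => \int[mu]_(x in Omega) dotv (F n x) (grad phi x)) = fun=> f phi.
  by apply/funext => n; have /admissible_fluxP[_] := AF n; apply.
by move: lim; rewrite E => /cvg_lim <-//; rewrite lim_cst.
Qed.

Lemma exists_min_flux b : A !=set0 -> Theta Omega kappa b ->
  exists tau, is_min A (J ^~ b) tau.
Proof.
move=> A0 tb; have mb : measurable_fun Omega b by case: tb.
have AL : A `<=` Lq q by move=> tau /admissible_fluxP[].
have [tau At tmin] := wenergy_minimizer mO Ooo q1 (measurable_weight c mb)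
  (fun x _ => weight_bounds c0 b x) A0 AL admissible_flux_mid admissible_flux_closed.
exists tau; split=> [|rho Ar]; first exact: At.
rewrite (dual_energyE oO bO c0 tb (AL _ At)) (dual_energyE oO bO c0 tb (AL _ Ar)).
by rewrite lee_fin; exact: tmin.
Qed.

Lemma exists_max_density tau : 0 < kappa -> (kappa%:E < mu Omega)%E -> A tau ->
  exists b, is_max (Theta Omega kappa) (J tau) b.
Proof.
move=> k0 kO /admissible_fluxP[Lt _].
have [b [mb b01 bk bmax]] := bathtub mO Ooo Lt.2 (fun x _ => powR_ge0 _ _) k0 kO.
have tb : Theta Omega kappa b by apply/(ThetaP kappa oO bO b); split=> //; exact: nearW.
exists b; split=> [|eta te]; first exact: tb.
rewrite (dual_energyE oO bO c0 tb Lt) (dual_energyE oO bO c0 te Lt) lee_fin.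
have split_energy g : Theta Omega kappa g ->
    weighted_energy mu Omega q (weight c g) tau =
    \int[mu]_(x in Omega) (enorm (tau x) `^ q) +
    c * \int[mu]_(x in Omega) (clip g x * enorm (tau x) `^ q).
  move=> tg; have mg : measurable_fun Omega g by case: tg.
  have Ig : mu.-integrable Omega (EFin \o (fun x => clip g x * enorm (tau x) `^ q)).
    apply: (ae_dominated_integrable mO _ _ Lt.2).
      apply: measurable_funM; first exact: measurable_clip.
      exact: measurable_fun_enorm_powR Lt.1.
    apply: nearW => x _; have /andP[g0 g1] := clip01 g x.
    by rewrite ger0_norm ?mulr_ge0 ?powR_ge0// ler_piMl// powR_ge0.
  rewrite wenergyE -(RintegralZl _ mO Ig) -(RintegralD mO Lt.2 (integrable_EFinZ mO c Ig)).
  by apply: eq_Rintegral => x _; rewrite /weight; ring.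
rewrite !split_energy// lerD2l ler_pM2l//.
have te' := Theta_clip oO bO te.
have /(ThetaP kappa oO bO (clip eta))[me e01 ek] := te'.
rewrite [X in _ <= X](@eq_Rintegral _ _ R mu Omega (fun x => b x * enorm (tau x) `^ q)).
  exact: bmax.
by move=> x; rewrite inE => Ox; rewrite clip_id// b01.
Qed.

End existence.

Theorem proposition3p1 (R : realType) (N : nat) (Omega : set 'rV[R]_N)
    (p p' alpha beta c kappa : R) (f : ('rV[R]_N -> R) -> R)
    (N_ge2 : (2 <= N)%N)
    (Omega_open : open Omega) (Omega_bounded : bounded_set Omega)
    (p_gt1 : 1 < p) (p'E : p' = p / (p - 1))
    (alpha_gt0 : 0 < alpha) (alpha_lt_beta : alpha < beta)
    (cE : c = (beta / alpha) `^ (1 / (p - 1)) - 1)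
    (kappa_gt0 : 0 < kappa) (kappa_lt : (kappa%:E < lebesgue_rV N Omega)%E)
    (f_dual : dual_W1p0 Omega p f)
    (u : 'rV[R]_N -> R) (G : 'rV[R]_N -> 'rV[R]_N) (theta : 'rV[R]_N -> R)
    (u_theta_sol : solves_R Omega p c kappa f u G theta) :
  let A := admissible_flux Omega f p' in
  let B := Theta Omega kappa in
  let J := dual_energy Omega c p' in
  let sigma := flux p c G theta in
  exists v : R,
    [/\ solves_minmax A B J sigma v%:E,
        (forall tau w, solves_minmax A B J tau w ->
          {ae lebesgue_rV N, forall x, Omega x -> tau x = sigma x}) &
        solves_maxmin A B J theta v%:E].
Proof.
move=> A B J sigma.
have p10 : 0 < p - 1 by rewrite subr_gt0.
have q1 : 1 < p' by rewrite p'E ltr_pdivlMr// mul1r ltrBlDr ltrDl.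
have c0 : 0 < c.
  have ba : 1 < beta / alpha by rewrite ltr_pdivlMr// mul1r.
  rewrite cE subr_gt0 (gt0_powRE _ (lt_trans ltr01 ba)) -[X in X < _]expR0 ltr_expR.
  by apply: mulr_gt0; [exact: divr_gt0|exact: ln_gt0].
have mO : measurable Omega := open_measurable_rV Omega_open.
have [_ tth _] := u_theta_sol; have mth : measurable_fun Omega theta by case: tth.
pose sigma0 := opt_flux p c G theta.
have ssE : {ae lebesgue_rV N, forall x, Omega x -> sigma x = sigma0 x}.
  apply: filterS (clip_ae tth) => x + Ox => /(_ Ox) E.
  by rewrite /sigma /flux /sigma0 /opt_flux /weight E.
have L0 : Lq_field (lebesgue_rV N) Omega p' sigma0.
  exact: (Lq_opt_flux Omega_open p_gt1 p'E c0 u_theta_sol).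
have msigma : measurable_fun Omega sigma.
  have mG : measurable_fun Omega G by case: u_theta_sol => -[[_ []]].
  apply: (measurable_fun_rVZ mO _ mG); apply: measurable_funM.
    exact: measurable_fun_enorm_powR mG.
  rewrite (_ : (fun x => _) = (fun x => (1 + c * theta x) `^ (- (p - 1)))); last first.
    by apply/funext => x; rewrite powRN.
  apply: (@measurableT_comp _ _ _ _ _ _ (@powR R ^~ (- (p - 1)))).
    exact: measurable_powR.
  by apply: measurable_funD => //; exact: measurable_funM.
have A0 : A sigma0.
  apply/(admissible_fluxP f Omega_open Omega_bounded q1); split=> // phi t.
  exact: (opt_flux_div Omega_open Omega_bounded p_gt1 p'E c0 f_dual u_theta_sol).
have As : A sigma := admissible_flux_ae Omega_open Omega_bounded q1 msigma ssE A0.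
have Js b : B b -> J sigma b = J sigma0 b.
  by move=> Bb; exact: (dual_energy_ae Omega_open Omega_bounded c0 Bb msigma ssE L0).
have max0 b : B b -> (J sigma b <= J sigma theta)%E.
  move=> Bb; rewrite (Js _ Bb) (Js _ tth).
  rewrite /J (dual_energyE Omega_open Omega_bounded c0 Bb L0).
  rewrite (dual_energyE Omega_open Omega_bounded c0 tth L0) lee_fin.
  exact: (opt_flux_max Omega_open Omega_bounded p_gt1 p'E c0 u_theta_sol Bb).
have min0 tau : A tau -> (J sigma theta <= J tau theta)%E.
  move=> /(admissible_fluxP f Omega_open Omega_bounded q1)[Lt td]; rewrite (Js _ tth).
  rewrite /J (dual_energyE Omega_open Omega_bounded c0 tth Lt).
  rewrite (dual_energyE Omega_open Omega_bounded c0 tth L0) lee_fin.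
  exact: (opt_flux_min Omega_open Omega_bounded p_gt1 p'E c0 f_dual u_theta_sol Lt td).
have exmax tau : A tau -> exists b, is_max B (J tau) b.
  exact: (exists_max_density Omega_open Omega_bounded q1 c0 kappa_gt0 kappa_lt).
have exmin b : B b -> exists tau, is_min A (J ^~ b) tau.
  by apply: (exists_min_flux Omega_open Omega_bounded q1 c0); exists sigma.
have vE : J sigma theta =
    (weighted_energy (lebesgue_rV N) Omega p' (weight c theta) sigma0)%:E.
  by rewrite (Js _ tth); exact: (dual_energyE Omega_open Omega_bounded c0 tth L0).
exists (weighted_energy (lebesgue_rV N) Omega p' (weight c theta) sigma0).
rewrite -vE; split.
- exact: (saddle_minmax As tth max0 min0 exmax).
- move=> tau v /(saddle_minmax_le As tth max0)[At].
  have /(admissible_fluxP f Omega_open Omega_bounded q1)[Lt td] := At.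
  rewrite vE /J (dual_energyE Omega_open Omega_bounded c0 tth Lt) lee_fin => le.
  have /(admissible_fluxP f Omega_open Omega_bounded q1)[Lm md] :=
    admissible_flux_mid Omega_open Omega_bounded q1 At A0.
  (* the midpoint of tau and sigma0 cannot do better than sigma0 *)
  have le0 := opt_flux_min Omega_open Omega_bounded p_gt1 p'E c0 f_dual u_theta_sol Lm md.
  have E := wenergy_minimizer_unique mO q1 (measurable_weight c mth)
    (fun x _ => weight_bounds c0 theta x) Lt L0 (le_trans le le0) le0.
  by apply: filterS2 ssE E => x sE tE Ox; rewrite sE// tE.
- exact: (saddle_maxmin As tth max0 min0 exmin).
Qed.
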